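(* Let $(A,\mathfrak m)$ be a non-regular Gorenstein local ring of dimension $d\ge 1$. Let $N$ be a perfect $A$-module of dimension $t\ge 1$ and let $I$ be an ideal of definition of $N$. If $\operatorname{pdim}_A(N/I^{n+1}N)<\infty$ for all $n\ge 0$, then for every maximal Cohen-Macaulay $A$-module $M$, $$\operatorname{depth} G_I(M\otimes_A N)\ge\operatorname{depth} G_I(N).$$
   Context: All rings are commutative Noetherian and all modules are finitely generated. $\operatorname{pdim}_A$ denotes projective dimension. Over a Cohen-Macaulay local ring, a non-zero module $N$ is perfect if and only if it is Cohen-Macaulay of finite projective dimension. An ideal of definition of $N$ is an ideal $I\subseteq\mathfrak m$ such that $N/IN$ has finite length. $G_I(A)=\bigoplus_{n\ge0}I^n/I^{n+1}$ is the associated graded ring, with unique graded maximal ideal $\mathfrak M_G=\mathfrak m/I\oplus\bigoplus_{n\ge1}I^n/I^{n+1}$. For an $A$-module $X$, $G_I(X)=\bigoplus_{n\ge0}I^nX/I^{n+1}X$, a graded $G_I(A)$-module, and $\operatorname{depth}G_I(X)=\operatorname{grade}(\mathfrak M_G,G_I(X))$. *)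

(* Defs.v *)
From HB Require Import structures.
From mathcomp Require Import all_boot all_algebra.
From mathcomp Require Import boolp functions.
From mathcomp Require Import freeg.

Set Implicit Arguments.
Unset Strict Implicit.
Unset Printing Implicit Defensive.

Import GRing.Theory.

Local Open Scope ring_scope.
Local Open Scope quotient_scope.

(* None is infinity. *)
Definition enat := option nat.

Definition enat_le (a b : enat) : bool :=
  match a, b with
  | _, None => true
  | None, Some _ => false
  | Some m, Some n => (m <= n)%N
  end.

Definition enat_inf (S : nat -> Prop) : enat :=
  if pselect (exists n, `[< S n >]) is left h then Some (ex_minn h) else None.

(* Infinity for unbounded sets, and 0 for the empty set. *)
Definition enat_sup (S : nat -> Prop) : enat :=
  enat_inf (fun m => forall k, S k -> (k <= m)%N).

Section QuotientModule.
Variables (R : pzRingType) (X : lmodType R) (U : submodClosed X).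

(* submodClosed does not inherit from zmodClosed, which Quotient.quot expects *)
Definition zmod_pred : {pred X} := U.
HB.instance Definition _ := GRing.isZmodClosed.Build X zmod_pred
  (GRing.submod_closedB (submodClosedP U)).

Definition quotmod : Type := Quotient.quot zmod_pred.

HB.instance Definition _ := Choice.on quotmod.
HB.instance Definition _ := GRing.Zmodule.on quotmod.
HB.instance Definition _ := EqQuotient.on quotmod.

Definition quotmod_pi (x : X) : quotmod := \pi_(Quotient.quot zmod_pred) x.
Definition quotmod_scale (a : R) (x : quotmod) : quotmod :=
  quotmod_pi (a *: (repr (x : Quotient.quot zmod_pred))).

Lemma quotmod_piP (x y : X) : quotmod_pi x = quotmod_pi y <-> x - y \in U.
Proof.
split=> [/eqP h|h]; last apply/eqP.
  by have := Quotient.idealrBE zmod_pred x y; rewrite h.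
by have := Quotient.idealrBE zmod_pred x y; rewrite h => /esym.
Qed.

Lemma quotmod_piD : {morph quotmod_pi : x y / x + y}.
Proof. by move=> x y; rewrite /quotmod_pi raddfD. Qed.

Lemma quotmod_reprK (x : quotmod) :
  quotmod_pi (repr (x : Quotient.quot zmod_pred)) = x.
Proof. exact: reprK. Qed.

Lemma quotmod_scale_pi a x : quotmod_scale a (quotmod_pi x) = quotmod_pi (a *: x).
Proof.
apply/quotmod_piP; rewrite -scalerBr; apply: rpredZ.
by apply/quotmod_piP; rewrite quotmod_reprK.
Qed.

Fact quotmod_scalerA a b x :
  quotmod_scale a (quotmod_scale b x) = quotmod_scale (a * b) x.
Proof. by rewrite -(quotmod_reprK x) !quotmod_scale_pi scalerA. Qed.
Fact quotmod_scale1r : left_id 1 quotmod_scale.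
Proof. by move=> x; rewrite -(quotmod_reprK x) quotmod_scale_pi scale1r. Qed.
Fact quotmod_scalerDr : right_distributive quotmod_scale +%R.
Proof.
move=> a x y; rewrite -(quotmod_reprK x) -(quotmod_reprK y).
by rewrite -quotmod_piD !quotmod_scale_pi -quotmod_piD scalerDr.
Qed.
Fact quotmod_scalerDl x : {morph quotmod_scale^~ x : a b / a + b}.
Proof.
move=> a b /=; rewrite -(quotmod_reprK x) !quotmod_scale_pi -quotmod_piD.
by rewrite scalerDl.
Qed.

HB.instance Definition _ := GRing.Zmodule_isLmodule.Build R quotmod
  quotmod_scalerA quotmod_scale1r quotmod_scalerDr quotmod_scalerDl.

End QuotientModule.

Section Spans.
Variables (R : comNzRingType) (X : lmodType R).

Definition span (s : seq X) : {pred X} :=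
  [pred x | `[< exists c : nat -> R, x = \sum_(i < size s) c i *: s`_i >]].

Definition fin_generated : Prop := exists s : seq X, forall x : X, x \in span s.

Definition nonzero_module : Prop := exists x : X, x != 0.

(* (a_1, ..., a_k) X *)
Definition seq_mul (s : seq R) : {pred X} :=
  [pred x | `[< exists y : nat -> X, x = \sum_(i < size s) s`_i *: y i >]].

(* J U, for subsets J of R and U of X *)
Definition smul (J : {pred R}) (U : {pred X}) : {pred X} :=
  [pred x | `[< exists2 s : seq (R * X),
      all (fun p => (p.1 \in J) && (p.2 \in U)) s
      & x = \sum_(p <- s) p.1 *: p.2 >]].

Definition annihilator : {pred R} := [pred a | `[< forall x : X, a *: x = 0 >]].

End Spans.
Arguments seq_mul {R} X s.
Arguments annihilator {R} X.

Definition pow_mul (R : comNzRingType) (I : idealr R) (X : lmodType R) (n : nat)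
  : {pred X} := iter n (smul I) predT.
Arguments pow_mul {R} I X n.

Definition ideal_pow (R : comNzRingType) (I : idealr R) (n : nat) : {pred R} :=
  pow_mul I R^o n.

Section PowSubmodule.
Variables (R : comNzRingType) (I : idealr R).

Lemma smul_sub (X : lmodType R) (U : {pred X}) : submod_closed (smul I U).
Proof.
split=> [|a x y]; first by apply/asboolP; exists [::]; rewrite ?big_nil.
move=> /asboolP[s hs ->] /asboolP[t ht ->]; apply/asboolP.
exists ([seq (a * p.1, p.2) | p <- s] ++ t).
  rewrite all_cat ht andbT all_map; apply: sub_all hs => p /= /andP[hp ->].
  by rewrite idealMr.
rewrite big_cat big_map /= scaler_sumr; congr (_ + _).
by apply: eq_bigr => p _; rewrite scalerA.
Qed.

Lemma pow_mul_sub (X : lmodType R) n : submod_closed (pow_mul I X n).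
Proof. by case: n => [|n]; [split | exact: smul_sub]. Qed.

HB.instance Definition _ (X : lmodType R) n :=
  GRing.isSubmodClosed.Build R X (pow_mul I X n) (pow_mul_sub X n).

Lemma pow_mulM (X : lmodType R) m n a (x : X) :
  a \in ideal_pow I m -> x \in pow_mul I X n -> a *: x \in pow_mul I X (m + n).
Proof.
elim: m a x => [|m IHm] a x; first by move=> _ hx; apply: rpredZ.
move=> /asboolP[s hs ->] hx; apply/asboolP.
exists [seq (p.1, p.2 *: x) | p <- s].
  rewrite all_map; apply: sub_all hs => p /= /andP[-> hp] /=.
  exact: IHm.
by rewrite big_map scaler_suml; apply: eq_bigr => p _; rewrite scalerA.
Qed.

Lemma pow_mulM_eq (X : lmodType R) m n k a (x : X) : (m + n)%N = k ->
  a \in ideal_pow I m -> x \in pow_mul I X n -> a *: x \in pow_mul I X k.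
Proof. by move=> <-; apply: pow_mulM. Qed.

End PowSubmodule.

Section Homological.
Variable R : comNzRingType.

Definition exact_at (U V W : lmodType R) (f : U -> V) (g : V -> W) : Prop :=
  forall v, g v = 0 <-> exists u, f u = v.

Definition projective (P : lmodType R) : Prop :=
  forall (U V : lmodType R) (p : {linear U -> V}) (f : {linear P -> V}),
    (forall v, exists u, p u = v) ->
    exists g : {linear P -> U}, forall x, p (g x) = f x.

Definition injective_module (E : lmodType R) : Prop :=
  forall (U V : lmodType R) (i : {linear U -> V}) (f : {linear U -> E}),
    injective i -> exists g : {linear V -> E}, forall x, g (i x) = f x.

(* 0 -> P_n -> ... -> P_1 -> P_0 -> X -> 0 *)
Definition has_proj_resolution (X : lmodType R) (n : nat) : Prop :=
  exists (P : nat -> lmodType R) (d : forall i, {linear P i.+1 -> P i})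
         (e : {linear P 0%N -> X}),
  [/\ forall i, projective (P i),
      forall x, exists y, e y = x,
      exact_at (d 0%N) e,
      forall i, exact_at (d i.+1) (d i)
    & forall i, (n < i)%N -> forall x : P i, x = 0].

(* 0 -> X -> E^0 -> E^1 -> ... -> E^n -> 0 *)
Definition has_inj_resolution (X : lmodType R) (n : nat) : Prop :=
  exists (E : nat -> lmodType R) (d : forall i, {linear E i -> E i.+1})
         (e : {linear X -> E 0%N}),
  [/\ forall i, injective_module (E i),
      injective e,
      exact_at e (d 0%N),
      forall i, exact_at (d i) (d i.+1)
    & forall i, (n < i)%N -> forall x : E i, x = 0].

Definition pdim (X : lmodType R) : enat := enat_inf (has_proj_resolution X).
Definition injdim (X : lmodType R) : enat := enat_inf (has_inj_resolution X).

End Homological.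

Section Invariants.
Variables (R : comNzRingType) (X : lmodType R).

Definition regular_seq (s : seq R) : Prop :=
  (forall i, (i < size s)%N -> forall x : X,
     s`_i *: x \in seq_mul X (take i s) -> x \in seq_mul X (take i s))
  /\ (exists x : X, x \notin seq_mul X s).

(* The convention is that the grade is infinite when J X = X. *)
Definition grade (J : {pred R}) : enat :=
  if pselect (forall x : X, x \in smul J predT) then None
  else enat_sup (fun n => exists s : seq R,
         [/\ size s = n, {subset s <= J} & regular_seq s]).

(* The dimension of R/J, as the supremum of the lengths n of chains
   p_0 < ... < p_n of primes of R that contain J. *)
Definition quot_dim (J : {pred R}) : enat :=
  enat_sup (fun n => exists p : nat -> prime_idealr R,
    [/\ forall i, (i <= n)%N -> {subset J <= p i},
        forall i, (i < n)%N -> {subset p i <= p i.+1}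
      & forall i, (i < n)%N -> exists2 a, a \in p i.+1 & a \notin p i]).

Definition mod_dim : enat := quot_dim (annihilator X).

Definition mod_length : enat :=
  enat_sup (fun n => exists u : nat -> submodClosed X,
    (forall i, (i < n)%N -> {subset u i <= u i.+1}) /\
    (forall i, (i < n)%N -> exists2 x, x \in u i.+1 & x \notin u i)).

Definition finite_length : Prop := mod_length <> None.

End Invariants.

Definition ring_dim (R : comNzRingType) : enat := quot_dim (pred1 (0 : R)).

(* For finitely generated X over a Noetherian R, this is also the least i such
   that Ext^i(X, R) is non-zero. *)
Definition mod_grade (R : comNzRingType) (X : lmodType R) : enat :=
  grade R^o (annihilator X).

Definition perfect (R : comNzRingType) (X : lmodType R) : Prop :=
  [/\ fin_generated X, nonzero_module X & pdim X = mod_grade X].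

Section Rings.
Variable R : comNzRingType.

Definition noetherian : Prop :=
  forall J : idealr R, exists s : seq R^o, forall a : R, (a \in J) = (a \in span s).

(* An idealr is proper by definition, so J below ranges over proper ideals. *)
Definition maximal_ideal (m : idealr R) : Prop :=
  forall J : idealr R, {subset m <= J} -> {subset J <= m}.

Definition noetherian_local (m : idealr R) : Prop :=
  [/\ noetherian, maximal_ideal m
    & forall m' : idealr R, maximal_ideal m' -> m' =i m].

Definition regular_local (m : idealr R) : Prop :=
  exists s : seq R^o,
    ring_dim R = Some (size s) /\ (forall a : R, (a \in m) = (a \in span s)).

Definition gorenstein_local (m : idealr R) : Prop :=
  noetherian_local m /\ injdim R^o <> None.

Definition cohen_macaulay (m : idealr R) (X : lmodType R) : Prop :=
  [/\ fin_generated X, nonzero_module X & grade X m = mod_dim X].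

Definition maximal_CM (m : idealr R) (X : lmodType R) : Prop :=
  cohen_macaulay m X /\ mod_dim X = ring_dim R.

End Rings.

Section Tensor.
Variables (R : comNzRingType) (M N : lmodType R).

Local Notation F := {freeg (M * N) / R}.
Local Notation "[ x , y ]" := (<< (x, y) >> : F).

Inductive tensor_rel : F -> Prop :=
| tensor_relDl x x' y : tensor_rel ([x + x', y] - [x, y] - [x', y])
| tensor_relDr x y y' : tensor_rel ([x, y + y'] - [x, y] - [x, y'])
| tensor_relZl a x y : tensor_rel ([a *: x, y] - a *: [x, y])
| tensor_relZr a x y : tensor_rel ([x, a *: y] - a *: [x, y]).

Definition tensor_ker : {pred F} :=
  [pred z | `[< forall U : submodClosed F,
                  (forall r, tensor_rel r -> r \in U) -> z \in U >]].

Lemma tensor_ker_sub : submod_closed tensor_ker.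
Proof.
split=> [|a x y]; first by apply/asboolP => U _; apply: rpred0.
move=> /asboolP hx /asboolP hy; apply/asboolP => U hU.
by rewrite rpredD ?rpredZ ?hx ?hy.
Qed.

HB.instance Definition _ :=
  GRing.isSubmodClosed.Build R F tensor_ker tensor_ker_sub.

Definition tensor : lmodType R := quotmod tensor_ker.

Definition tens (x : M) (y : N) : tensor := quotmod_pi tensor_ker [x, y].

Lemma tensor_rel_ker r : tensor_rel r -> r \in tensor_ker.
Proof. by move=> hr; apply/asboolP => U; apply. Qed.

Lemma tensDl x x' y : tens (x + x') y = tens x y + tens x' y.
Proof.
rewrite -quotmod_piD; apply/quotmod_piP; rewrite opprD addrA.
exact/tensor_rel_ker/tensor_relDl.
Qed.

Lemma tensDr x y y' : tens x (y + y') = tens x y + tens x y'.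
Proof.
rewrite -quotmod_piD; apply/quotmod_piP; rewrite opprD addrA.
exact/tensor_rel_ker/tensor_relDr.
Qed.

Lemma tensZl a x y : tens (a *: x) y = a *: tens x y.
Proof.
rewrite [RHS]quotmod_scale_pi; apply/quotmod_piP.
exact/tensor_rel_ker/tensor_relZl.
Qed.

Lemma tensZr a x y : tens x (a *: y) = a *: tens x y.
Proof.
rewrite [RHS]quotmod_scale_pi; apply/quotmod_piP.
exact/tensor_rel_ker/tensor_relZr.
Qed.

Lemma tensor_ind (P : tensor -> Prop) :
  (forall u v, P u -> P v -> P (u + v)) -> (forall x y, P (tens x y)) ->
  forall u, P u.
Proof.
move=> PD Pt u; rewrite -[u]quotmod_reprK.
set r := repr _; rewrite -(freeg_sumE r).
elim: (dom r) => [|k s IHs].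
  rewrite big_nil; suff -> : quotmod_pi tensor_ker 0 = tens (0 *: 0) 0.
    exact: Pt.
  rewrite tensZl scale0r.
  exact: (raddf0 (\pi_(Quotient.quot (zmod_pred tensor_ker)))).
rewrite big_cons quotmod_piD; apply: PD => //.
case: k => x y; set a := coeff _ _.
suff -> : quotmod_pi tensor_ker << a *g (x, y) >> = tens (a *: x) y by [].
rewrite tensZl [RHS]quotmod_scale_pi; congr (quotmod_pi _ _).
by apply/eqP/freeg_eqP => k; rewrite coeffZ !coeffU mul1r.
Qed.

Lemma tensor_lift (P : lmodType R) (b : M -> N -> P) :
  (forall x x' y, b (x + x') y = b x y + b x' y) ->
  (forall x y y', b x (y + y') = b x y + b x y') ->
  (forall a x y, b (a *: x) y = a *: b x y) ->
  (forall a x y, b x (a *: y) = a *: b x y) ->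
  exists2 h : {linear tensor -> P}, (forall x y, h (tens x y) = b x y)
    & forall h' : {linear tensor -> P},
        (forall x y, h' (tens x y) = b x y) -> h' =1 h.
Proof.
move=> bDl bDr bZl bZr.
pose L (z : F) : P := fglift (fun k => b k.1 k.2) z.
have LB : zmod_morphism L by exact: lift_is_additive.
pose La : {additive F -> P} := HB.pack L (GRing.isZmodMorphism.Build F P L LB).
have L0 : L 0 = 0 by exact: (raddf0 La).
have LD u v : L (u + v) = L u + L v by exact: (raddfD La).
have LN u v : L (u - v) = L u - L v by exact: (raddfB La).
have LZ : scalable L.
  move=> a z; rewrite -(freeg_sumE z) scaler_sumr.
  rewrite ![L _](raddf_sum La) scaler_sumr; apply: eq_bigr => k _.
  have -> : a *: << coeff k z *g k >> = << a * coeff k z *g k >> :> F.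
    by apply/eqP/freeg_eqP => k'; rewrite coeffZ !coeffU mulrA.
  by rewrite /= /L !liftU scalerA.
have L1 x y : L [x, y] = b x y by rewrite /L liftU scale1r.
pose K : {pred F} := [pred z | L z == 0].
have Ksub : submod_closed K.
  split=> [|a u v]; first by rewrite inE L0.
  by rewrite !inE => /eqP hu /eqP hv; rewrite LD LZ hu hv scaler0 addr0.
pose Ks : submodClosed F := HB.pack K (GRing.isSubmodClosed.Build R F K Ksub).
have Lker z : z \in tensor_ker -> L z = 0.
  move=> /asboolP /(_ Ks) h; apply/eqP; apply: h => r.
  case=> *; rewrite inE !LN ?LZ !L1 ?bDl ?bDr ?bZl ?bZr ?subrr //.
    by rewrite addrAC addrK subrr.
  by rewrite addrAC addrK subrr.
pose h (u : tensor) : P := L (repr (u : Quotient.quot (zmod_pred tensor_ker))).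
have hpi z : h (quotmod_pi tensor_ker z) = L z.
  apply/eqP; rewrite -subr_eq0 -LN; apply/eqP/Lker.
  by apply/quotmod_piP; rewrite quotmod_reprK.
have hlin : linear h.
  move=> a u v; rewrite -[u]quotmod_reprK -[v]quotmod_reprK.
  rewrite [a *: _]quotmod_scale_pi -quotmod_piD !hpi.
  by rewrite LD LZ.
pose hl : {linear tensor -> P} := HB.pack h (GRing.isLinear.Build R tensor P _ h hlin).
have hE x y : hl (tens x y) = b x y by rewrite /= [LHS]hpi L1.
exists hl => // h' h'E; apply: tensor_ind => [u v hu hv|x y].
  by rewrite [LHS](raddfD h') [RHS](raddfD hl); congr (_ + _).
by rewrite h'E hE.
Qed.

End Tensor.
Arguments tensor {R} M N.

Section AssociatedGraded.
Variables (A : comNzRingType) (I : idealr A).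

(* The Rees ring (+)_n I^n T^n, as a subring of A[T]. *)
Definition rees_pred : {pred {poly A}} :=
  [pred f : {poly A} | `[< forall n, f`_n \in ideal_pow I n >]].

Fact rees_sub : subring_closed rees_pred.
Proof.
split=> [|f g /asboolP hf /asboolP hg|f g /asboolP hf /asboolP hg];
  apply/asboolP => n.
- by rewrite coef1; case: n => [|n]; [| exact: (rpred0 (pow_mul I A^o n.+1))].
- by rewrite coefB; apply: (@rpredB _ (pow_mul I A^o n)); [exact: hf | exact: hg].
rewrite coefM; apply: (@rpred_sum _ (pow_mul I A^o n)) => i _.
by apply: (@pow_mulM_eq _ I A^o _ _ _ _ _ _ (hf i) (hg _)); rewrite subnKC // -ltnS.
Qed.
HB.instance Definition _ := GRing.isSubringClosed.Build {poly A} rees_pred rees_sub.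

Definition rees : Type := {f | f \in rees_pred}.
HB.instance Definition _ := SubChoice.on rees.
HB.instance Definition _ := [SubChoice_isSubComNzRing of rees by <:].

(* the ideal (+)_n I^(n+1) T^n *)
Definition rees_ideal : {pred rees} :=
  [pred f : rees | `[< forall n, (val f)`_n \in ideal_pow I n.+1 >]].

Lemma ideal_pow1 a : a \in ideal_pow I 1 -> a \in I.
Proof.
move=> /asboolP[s hs ->]; rewrite big_seq; apply: rpred_sum => p hp.
rewrite [_ *: _]mulrC idealMr //.
by have /andP[] := allP hs p hp.
Qed.

Fact rees_idealP : idealr_closed rees_ideal.
Proof.
split=> [||f g h /asboolP hg /asboolP hh].
- by apply/asboolP => n; rewrite coef0; exact: (rpred0 (pow_mul I A^o n.+1)).
- apply/asboolP => /(_ 0%N); rewrite coef1 /= => /ideal_pow1.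
  by rewrite idealr1.
apply/asboolP => n; rewrite coefD coefM.
apply: (@rpredD _ (pow_mul I A^o n.+1)); last exact: hh.
apply: (@rpred_sum _ (pow_mul I A^o n.+1)) => i _.
have /asboolP hf := valP f.
apply: (@pow_mulM_eq _ I A^o _ _ _ _ _ _ (hf i) (hg _)).
by rewrite addnS subnKC // -ltnS.
Qed.
HB.instance Definition _ := isIdealr.Build rees rees_ideal rees_idealP.

(* G_I(A) = (+)_n I^n / I^(n+1), obtained as (+)_n I^n modulo (+)_n I^(n+1):
   by gr_ring_piP, two elements of the Rees ring agree in G_I(A) iff for every n
   their components of degree n agree in I^n / I^(n+1). *)
Definition gr_ring : comNzRingType := {ideal_quot rees_ideal}.

Lemma gr_ring_piP (f g : rees) :
  \pi_{ideal_quot rees_ideal} f = \pi_{ideal_quot rees_ideal} g <->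
  forall n, (val f)`_n - (val g)`_n \in ideal_pow I n.+1.
Proof.
have -> : (forall n, (val f)`_n - (val g)`_n \in ideal_pow I n.+1) <->
          f - g \in rees_ideal.
  by split=> [h|/asboolP h]; [apply/asboolP|] => n; have := h n; rewrite coefB.
rewrite Quotient.idealrBE; split=> [->|/eqP //]; exact: eqxx.
Qed.

(* m/I (+) (+)_(n >= 1) I^n/I^(n+1) *)
Definition gr_max (m : idealr A) : {pred gr_ring} :=
  [pred g : gr_ring | `[< exists f : rees,
                  (val f)`_0 \in m /\ g = \pi_{ideal_quot rees_ideal} f >]].

Variable X : lmodType A.

(* The Rees module (+)_n I^n X: finitely supported sequences x with x_n in I^n X. *)
Definition rees_mod_pred : {pred nat -> X} :=
  [pred x : nat -> X | `[< (exists k, forall n, (k <= n)%N -> x n = 0)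
                /\ forall n, x n \in pow_mul I X n >]].

Fact rees_mod_sub : zmod_closed rees_mod_pred.
Proof.
split=> [|x y /asboolP[[k xk] hx] /asboolP[[l yl] hy]]; apply/asboolP; split.
- by exists 0%N.
- by move=> n; exact: (rpred0 (pow_mul I X n)).
- exists (maxn k l) => n; rewrite geq_max => /andP[kn ln].
  by transitivity (x n - y n); rewrite // xk // yl // subr0.
by move=> n; apply: rpredB.
Qed.
HB.instance Definition _ :=
  GRing.isZmodClosed.Build (nat -> X) rees_mod_pred rees_mod_sub.

Definition rees_mod : Type := {x : nat -> X | x \in rees_mod_pred}.
HB.instance Definition _ := SubChoice.on rees_mod.
HB.instance Definition _ := [SubChoice_isSubZmodule of rees_mod by <:].

(* The action of A[T] on X[T], with elements of X[T] as sequences. *)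
Definition conv (f : {poly A}) (x : nat -> X) : nat -> X :=
  fun n => \sum_(i < n.+1) f`_i *: x (n - i)%N.

Fact conv_rees (f : rees) (x : rees_mod) : conv (val f) (val x) \in rees_mod_pred.
Proof.
have /asboolP hf := valP f; have /asboolP[[k xk] hx] := valP x.
apply/asboolP; split=> [|n].
  exists (size (val f) + k)%N => n hn; apply: big1 => i _.
  have [hi|hi] := leqP (size (val f)) i; first by rewrite nth_default // scale0r.
  rewrite xk ?scaler0 // -(leq_add2l i) subnKC; last by rewrite -ltnS.
  by rewrite (leq_trans _ hn) // leq_add2r ltnW.
rewrite /conv; apply: rpred_sum => i _.
by apply: (pow_mulM_eq _ (hf i) (hx _)); rewrite subnKC // -ltnS.
Qed.

Definition rees_scale (f : rees) (x : rees_mod) : rees_mod :=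
  Sub (conv (val f) (val x)) (conv_rees f x).

Fact rees_scalerA f g x : rees_scale f (rees_scale g x) = rees_scale (f * g) x.
Proof.
apply/val_inj/funext => n /=; rewrite /conv.
pose F j k := (val f)`_j *: ((val g)`_(k - j) *: (val x) (n - k)%N).
transitivity (\sum_(k < n.+1) \sum_(j < n.+1 | (j <= k)%N) F j k).
  rewrite (exchange_big_dep predT) //=; apply: eq_bigr => j _.
  rewrite scaler_sumr -(big_mkord (fun k => (j <= k)%N) (fun k => F j k)).
  rewrite -(big_mkord predT (fun k => (val f)`_j *:
     ((val g)`_k *: (val x) (n - j - k)%N))).
  rewrite [RHS](big_cat_nat (n := j)) //=; last by rewrite ltnW.
  rewrite [X in _ = X + _]big1_seq ?add0r; last first.
    by move=> k /andP[jk]; rewrite mem_index_iota ltnNge jk andbF.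
  rewrite [RHS](_ : _ = \sum_(0 + j <= k < n.+1 | (j <= k)%N) F j k); last by rewrite add0n.
  rewrite big_addn subSn; last by rewrite -ltnS.
  rewrite [RHS]big_mkcond /=; apply: eq_bigr => k _.
  by rewrite leq_addl /F addnK subnDA subnAC.
apply: eq_bigr => k _; rewrite coefM scaler_suml.
rewrite -(big_mkord (fun j => (j <= k)%N) (fun j => F j k)).
rewrite -(big_mkord predT (fun j => ((val f)`_j * (val g)`_(k - j)) *:
  (val x) (n - k)%N)).
rewrite (big_cat_nat (n := k.+1)) //= [X in _ + X]big1_seq ?addr0; last first.
  by move=> j /andP[jk]; rewrite mem_index_iota ltnNge jk.
rewrite big_seq_cond [RHS]big_seq; apply: eq_big => j.
  by rewrite mem_index_iota ltnS andbb.
by move=> _; rewrite /F scalerA.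
Qed.

Fact rees_scale1r : left_id 1 rees_scale.
Proof.
move=> x; apply/val_inj/funext => n /=; rewrite /conv big_ord_recl /=.
rewrite coef1 scale1r subn0 big1 ?addr0 // => i _.
by rewrite coef1 scale0r.
Qed.

Fact rees_scalerDr : right_distributive rees_scale +%R.
Proof.
move=> f x y; apply/val_inj/funext => n.
transitivity (conv (val f) (val x) n + conv (val f) (val y) n) => //.
rewrite /= /conv -big_split; apply: eq_bigr => i _.
exact: scalerDr.
Qed.

Fact rees_scalerDl x : {morph rees_scale^~ x : f g / f + g}.
Proof.
move=> f g; apply/val_inj/funext => n.
transitivity (conv (val f) (val x) n + conv (val g) (val x) n) => //.
by rewrite /= /conv -big_split; apply: eq_bigr => i _; rewrite coefD scalerDl.
Qed.

HB.instance Definition _ := GRing.Zmodule_isLmodule.Build rees rees_mod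
  rees_scalerA rees_scale1r rees_scalerDr rees_scalerDl.

(* (+)_n I^(n+1) X *)
Definition rees_mod_next : {pred rees_mod} :=
  [pred x : rees_mod | `[< forall n, (val x) n \in pow_mul I X n.+1 >]].

Fact rees_mod_next_sub : submod_closed rees_mod_next.
Proof.
split=> [|f x y /asboolP hx /asboolP hy]; apply/asboolP => n.
  exact: (rpred0 (pow_mul I X n.+1)).
apply: (@rpredD _ (pow_mul I X n.+1) (conv (val f) (val x) n) (val y n)) => //.
have /asboolP hf := valP f.
rewrite /conv; apply: rpred_sum => i _.
apply: (pow_mulM_eq _ (hf i) (hx _)).
by rewrite addnS subnKC // -ltnS.
Qed.
HB.instance Definition _ :=
  GRing.isSubmodClosed.Build rees rees_mod rees_mod_next rees_mod_next_sub.

(* G_I(X) = (+)_n I^n X / I^(n+1) X *)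
Definition gr_mod : Type := quotmod rees_mod_next.
HB.instance Definition _ := GRing.Zmodule.on gr_mod.

Definition gr_pi (x : rees_mod) : gr_mod := quotmod_pi rees_mod_next x.

Lemma gr_piP (x y : rees_mod) : gr_pi x = gr_pi y <->
  forall n, (val x) n - (val y) n \in pow_mul I X n.+1.
Proof.
rewrite [gr_pi x = gr_pi y]quotmod_piP.
by split=> [/asboolP h|h]; [|apply/asboolP] => n; exact: h.
Qed.

Lemma gr_ideal_scale (f : rees) (x : rees_mod) :
  f \in rees_ideal -> f *: x \in rees_mod_next.
Proof.
move=> /asboolP hf; have /asboolP[_ hx] := valP x.
apply/asboolP => n; rewrite [val _ _]/(conv (val f) (val x) n) /conv.
apply: rpred_sum => i _.
apply: (pow_mulM_eq _ (hf i) (hx _)).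
by rewrite addSn subnKC // -ltnS.
Qed.

(* G_I(A) acts on G_I(X) through representatives in the Rees ring. *)
Definition gr_scale (a : gr_ring) (x : gr_mod) : gr_mod :=
  (repr (a : {ideal_quot rees_ideal}) : rees) *: (x : quotmod rees_mod_next).

Lemma gr_scale_pi (f : rees) (x : rees_mod) :
  gr_scale (\pi_{ideal_quot rees_ideal} f) (gr_pi x) = gr_pi (f *: x).
Proof.
rewrite [LHS]quotmod_scale_pi; apply/quotmod_piP; rewrite -scalerBl.
by apply: gr_ideal_scale; rewrite Quotient.idealrBE reprK.
Qed.

Lemma gr_piD : {morph gr_pi : x y / x + y}.
Proof. exact: quotmod_piD. Qed.

Lemma gr_pi_surj (x : gr_mod) : exists y, x = gr_pi y.
Proof.
exists (repr (x : Quotient.quot (zmod_pred rees_mod_next))).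
by rewrite /gr_pi quotmod_reprK.
Qed.

Lemma gr_ring_surj (a : gr_ring) : exists f, a = \pi_{ideal_quot rees_ideal} f.
Proof. by exists (repr (a : {ideal_quot rees_ideal})); rewrite reprK. Qed.

Fact gr_scalerA a b x : gr_scale a (gr_scale b x) = gr_scale (a * b) x.
Proof.
have [f ->] := gr_ring_surj a; have [g ->] := gr_ring_surj b.
have [y ->] := gr_pi_surj x.
by rewrite -rmorphM !gr_scale_pi scalerA.
Qed.

Fact gr_scale1r : left_id 1 gr_scale.
Proof.
move=> x; have [y ->] := gr_pi_surj x.
by rewrite -(rmorph1 (\pi_{ideal_quot rees_ideal})) gr_scale_pi scale1r.
Qed.

Fact gr_scalerDr : right_distributive gr_scale +%R.
Proof.
move=> a x y; have [f ->] := gr_ring_surj a.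
have [x' ->] := gr_pi_surj x; have [y' ->] := gr_pi_surj y.
by rewrite -gr_piD !gr_scale_pi -gr_piD scalerDr.
Qed.

Fact gr_scalerDl x : {morph gr_scale^~ x : a b / a + b}.
Proof.
move=> a b /=; have [f ->] := gr_ring_surj a; have [g ->] := gr_ring_surj b.
have [y ->] := gr_pi_surj x.
by rewrite -raddfD !gr_scale_pi -gr_piD scalerDl.
Qed.

HB.instance Definition _ := GRing.Zmodule_isLmodule.Build gr_ring gr_mod
  gr_scalerA gr_scale1r gr_scalerDr gr_scalerDl.

End AssociatedGraded.
Arguments gr_ring {A} I.
Arguments gr_max {A} I m.
Arguments gr_mod {A} I X.

Definition depth_gr (A : comNzRingType) (m I : idealr A) (X : lmodType A) : enat :=
  grade (gr_mod I X) (gr_max I m).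

Definition ideal_of_definition (A : comNzRingType) (m I : idealr A) (N : lmodType A)
  : Prop :=
  {subset I <= m} /\ finite_length (quotmod (pow_mul I N 1)).

(* Main.v *)
Require Import Defs.
From HB Require Import structures.
From mathcomp Require Import all_boot all_algebra.
From mathcomp Require Import boolp.
From mathcomp Require Import freeg.
From mathcomp Require Import ring.

(** The modules N/I^(n+1)N are m-torsion and of finite flat dimension. Such a
    module X satisfies Tor_j(Y, X) = 0 for all finitely generated Y and j > d. For
    suppose that n > d is the last degree with Tor_n(-, X) <> 0. Then
    Tor_n(A/p, X) <> 0 for some prime p, and p = m, because an x in m outside p
    would be regular on A/p while Tor(A/p, X) is x-torsion. But A/m embeds in
    A/(a) for a maximal A-regular sequence a, whose length is at most d, so
    Tor_n(A/m, X) = 0. The same argument along an M-regular sequence of length d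
    brings the vanishing of Tor_j(M, X) from j > d down to j > 0. Hence M (x) -
    is exact on 0 -> I^n N/I^(n+1) N -> N/I^(n+1) N -> N/I^n N -> 0, so that
    G_I(M (x) N) = M (x) G_I(N). If s is G_I(N)-regular, then each
    G_I(N)/(s_1, ..., s_i) is again m-torsion of finite flat dimension, and the
    vanishing of Tor_1(M, -) on it shows that s is regular on M (x) G_I(N). *)

Set Implicit Arguments.
Unset Strict Implicit.
Unset Printing Implicit Defensive.

Import GRing.Theory.
Local Open Scope ring_scope.

(** * Modules and tensor products *)

(** Tor itself is never constructed. [tor_tors x n Y X] expresses, by recursion over flat
    presentations of X, that Tor_(n+1)(Y, X) is [x]-power torsion. The parameter [x] lets each
    exactness argument serve twice: a general [x] gives torsion, [x] = 1 gives vanishing. Degrees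
    are thus shifted by one, and [d <= n] stands for the degrees j > d.

    The obstacle is that G_I(N), as an A-module, is an infinite direct sum of the layers I^j
    N/I^(j+1) N. Each layer has finite flat dimension, but the bound read off from the resolutions
    depends on j. The vanishing theorem replaces all these bounds by d, and only then is the direct
    sum of finite flat dimension too.

    The tensor product M (x) G_I(N) is taken over A, not over G_I(A). Elements of G_I(A) therefore
    enter as commuting A-linear endomorphisms, and regular sequences are studied for such
    families. *)

Definition mklin (R : comNzRingType) (U V : lmodType R) (f : U -> V) (fL : linear f) :
  {linear U -> V} := HB.pack f (GRing.isLinear.Build R U V _ f fL).

Section Qpi.
Variables (A : comNzRingType) (X : lmodType A) (U : submodClosed X).

Fact quotmod_pi_is_linear : linear (quotmod_pi U).
Proof.
move=> a x y; rewrite quotmod_piD; congr (_ + _).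
by rewrite [RHS]quotmod_scale_pi.
Qed.
Definition qpi : {linear X -> quotmod U} := mklin quotmod_pi_is_linear.

Lemma qpi_surj q : exists x, qpi x = q.
Proof. by exists (repr (q : Quotient.quot (zmod_pred U))); exact: quotmod_reprK. Qed.

Lemma qpi_eq0 x : qpi x = 0 <-> x \in U.
Proof.
have -> : (0 : quotmod U) = quotmod_pi U 0 by rewrite -[LHS](linear0 qpi).
by rewrite [_ = _]quotmod_piP subr0.
Qed.

Lemma qpi_eq x y : qpi x = qpi y <-> x - y \in U.
Proof. exact: quotmod_piP. Qed.

End Qpi.

Section LinearTools.
Variable R : comNzRingType.
Implicit Types U V W X Y : lmodType R.

Fact scale_is_linear X (a : R) : linear (fun x : X => a *: x).
Proof. by move=> b x y /=; rewrite scalerDr !scalerA mulrC. Qed.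
Definition scale_lin X (a : R) : {linear X -> X} := mklin (@scale_is_linear X a).

Fact comp_is_linear U V W (f : {linear U -> V}) (g : {linear V -> W}) :
  linear (fun x => g (f x)).
Proof. by move=> a x y /=; rewrite !linearP. Qed.
Definition comp_lin U V W (g : {linear V -> W}) (f : {linear U -> V}) :=
  mklin (comp_is_linear f g).

Fact id_is_linear X : linear (fun x : X => x).
Proof. by []. Qed.
Definition id_lin X : {linear X -> X} := mklin (@id_is_linear X).

Definition subspace X (P : X -> Prop) :=
  P 0 /\ forall a x y, P x -> P y -> P (a *: x + y).

Section Subspace.
Variables (X : lmodType R) (P : X -> Prop).

Definition sub_pred : {pred X} := [pred x | `[< P x >]].
Hypothesis PS : subspace P.

Fact sub_pred_closed : submod_closed sub_pred.
Proof.
case: PS => P0 PD; split=> [|a x y]; first exact/asboolP.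
by move=> /asboolP hx /asboolP hy; apply/asboolP/PD.
Qed.

Definition sub_of : submodClosed X :=
  HB.pack sub_pred (GRing.isSubmodClosed.Build R X sub_pred sub_pred_closed).

Lemma subspaceD x y : P x -> P y -> P (x + y).
Proof. by move=> hx hy; rewrite -[x]scale1r; apply: PS.2. Qed.
Lemma subspace_sum_seq (J : eqType) (s : seq J) (F : J -> X) :
  (forall j, j \in s -> P (F j)) -> P (\sum_(j <- s) F j).
Proof.
elim: s => [|j s IH] hF; first by rewrite big_nil; case: PS.
rewrite big_cons; apply: subspaceD; first by apply: hF; rewrite mem_head.
by apply: IH => k hk; apply: hF; rewrite inE hk orbT.
Qed.

Lemma ex_quotient : exists (Q : lmodType R) (p : {linear X -> Q}),
  (forall q, exists x, p x = q) /\ (forall x, p x = 0 <-> P x).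
Proof.
exists (quotmod sub_of : lmodType R), (qpi sub_of); split=> [q|x].
  exact: qpi_surj.
by rewrite qpi_eq0; split=> [/asboolP|h]; last exact/asboolP.
Qed.

Definition sub_type : Type := {x | x \in sub_of}.
HB.instance Definition _ := SubChoice.on sub_type.
HB.instance Definition _ := [SubChoice_isSubLmodule of sub_type by <:].

Lemma ex_submodule : exists (S : lmodType R) (i : {linear S -> X}),
  injective i /\ (forall x, P x <-> exists s, i s = x).
Proof.
have vL : linear (val : sub_type -> X) by move=> a x y; rewrite linearP.
exists (sub_type : lmodType R), (mklin vL); split=> [x y /= e|x]; first exact: val_inj.
split=> [h|[s <-]]; last by have /asboolP := valP s.
have h' : x \in sub_of by apply/asboolP.
by exists (Sub x h' : sub_type); exact: SubK.
Qed.

End Subspace.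

Lemma ker_subspace U V (f : {linear U -> V}) : subspace (fun x => f x = 0).
Proof.
by split=> [|a x y hx hy]; rewrite ?linear0 // linearP hx hy scaler0 addr0.
Qed.

Lemma im_subspace U V (f : {linear U -> V}) : subspace (fun y => exists x, f x = y).
Proof.
split=> [|a _ _ [x <-] [y <-]]; first by exists 0; rewrite linear0.
by exists (a *: x + y); rewrite linearP.
Qed.

Lemma lin_inj U V (f : {linear U -> V}) : (forall x, f x = 0 -> x = 0) -> injective f.
Proof.
by move=> h x y exy; apply/subr0_eq/h; rewrite linearB exy subrr.
Qed.

Definition ses U V W (i : {linear U -> V}) (p : {linear V -> W}) :=
  [/\ injective i, exact_at i p & forall w, exists v, p v = w].

Lemma ses0 U V W (i : {linear U -> V}) (p : {linear V -> W}) u :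
  ses i p -> p (i u) = 0.
Proof. by case=> _ e _; apply/e; exists u. Qed.

Lemma lin_lift_surj U V W (p : {linear U -> V}) (f : {linear U -> W}) :
  (forall v, exists u, p u = v) -> (forall u, p u = 0 -> f u = 0) ->
  exists g : {linear V -> W}, forall u, g (p u) = f u.
Proof.
move=> /choice[s hs] hf.
have E u : f (s (p u)) = f u.
  by apply/subr0_eq; rewrite -linearB; apply: hf; rewrite linearB hs subrr.
have gL : linear (fun v => f (s v)).
  move=> a x y; rewrite -[in X in f (s X)](hs x) -[in X in f (s X)](hs y) -linearP E.
  by rewrite linearP.
by exists (mklin gL) => u; rewrite /= E.
Qed.

Lemma lin_lift_inj U V W (i : {linear U -> V}) (f : {linear W -> V}) :
  injective i -> (forall w, exists u, i u = f w) ->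
  exists g : {linear W -> U}, forall w, i (g w) = f w.
Proof.
move=> iI /choice[g hg].
have gL : linear g by move=> a x y; apply: iI; rewrite linearP !hg linearP.
by exists (mklin gL).
Qed.

Lemma ex_ker U V (p : {linear U -> V}) :
  (forall v, exists u, p u = v) ->
  exists (K : lmodType R) (i : {linear K -> U}), ses i p.
Proof.
move=> ps; have [K [i [iI hi]]] := ex_submodule (ker_subspace p).
by exists K, i; split=> // v; rewrite -hi.
Qed.

Lemma ex_coker U V (i : {linear U -> V}) :
  injective i -> exists (W : lmodType R) (p : {linear V -> W}), ses i p.
Proof.
move=> iI; have [W [p [ps hp]]] := ex_quotient (im_subspace i).
by exists W, p; split=> // v; rewrite hp.
Qed.

End LinearTools.

(** * Functoriality, right exactness and flatness of the tensor product *)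

Section TensorFunctor.
Variable R : comNzRingType.
Implicit Types L G Y K F X M N P U V W : lmodType R.

Lemma tensor_ext M N P (f g : {linear @tensor R M N -> P}) :
  (forall x y, f (tens x y) = g (tens x y)) -> f =1 g.
Proof.
move=> h u; elim/tensor_ind: u => [u v hu hv|x y]; last exact: h.
by rewrite !linearD hu hv.
Qed.

Lemma tmap_ex M N M' N' (f : {linear M -> M'}) (g : {linear N -> N'}) :
  exists h : {linear @tensor R M N -> tensor M' N'},
    forall x y, h (tens x y) = tens (f x) (g y).
Proof.
have [||||h hE _] := @tensor_lift R M N (tensor M' N') (fun x y => tens (f x) (g y)).
- by move=> x x' y; rewrite linearD tensDl.
- by move=> x y y'; rewrite linearD tensDr.
- by move=> a x y; rewrite linearZ tensZl.
- by move=> a x y; rewrite linearZ tensZr.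
by exists h.
Qed.

Definition tmap M N M' N' (f : {linear M -> M'}) (g : {linear N -> N'}) :
  {linear @tensor R M N -> tensor M' N'} := projT1 (cid (tmap_ex f g)).

Lemma tmapE M N M' N' (f : {linear M -> M'}) (g : {linear N -> N'}) x y :
  tmap f g (tens x y) = tens (f x) (g y).
Proof. by rewrite /tmap; case: cid => h /= ->. Qed.

Definition tmapl M M' N (f : {linear M -> M'}) := tmap f (id_lin N).
Definition tmapr M N N' (g : {linear N -> N'}) := tmap (id_lin M) g.

Lemma tmaplr M N M' N' (f : {linear M -> M'}) (g : {linear N -> N'}) z :
  tmapl N' f (tmapr M g z) = tmapr M' g (tmapl N f z).
Proof.
apply: (@tensor_ext _ _ _ (comp_lin (tmapl N' f) (tmapr M g))
                   (comp_lin (tmapr M' g) (tmapl N f))) => x y /=.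
by rewrite !tmapE.
Qed.

Lemma tmapr_comp M N N' N'' (g : {linear N -> N'}) (h : {linear N' -> N''})
   (k : {linear N -> N''}) : (forall x, h (g x) = k x) ->
  forall z, tmapr M h (tmapr M g z) = tmapr M k z.
Proof.
move=> E; apply: (@tensor_ext _ _ _ (comp_lin (tmapr M h) (tmapr M g)) _) => x y /=.
by rewrite !tmapE /= E.
Qed.

Lemma tmapr_id M N (g : {linear N -> N}) : g =1 id -> tmapr M g =1 id.
Proof. by move=> E; apply: (@tensor_ext _ _ _ _ (id_lin _)) => x y; rewrite tmapE /= E. Qed.

Lemma tmapr0 M N N' (g : {linear N -> N'}) : (forall x, g x = 0) ->
  forall z, tmapr M g z = 0.
Proof.
move=> E; elim/tensor_ind => [u v hu hv|x y]; first by rewrite linearD hu hv addr0.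
by rewrite tmapE /= E -(scale0r 0) tensZr scale0r.
Qed.

Lemma tswap_ex M N : exists h : {linear @tensor R M N -> tensor N M},
    forall x y, h (tens x y) = tens y x.
Proof.
have [||||h hE _] := @tensor_lift R M N (tensor N M) (fun x y => tens y x).
- by move=> x x' y; rewrite tensDr.
- by move=> x y y'; rewrite tensDl.
- by move=> a x y; rewrite tensZr.
- by move=> a x y; rewrite tensZl.
by exists h.
Qed.

Definition tswap M N : {linear @tensor R M N -> tensor N M} :=
  projT1 (cid (tswap_ex M N)).

Lemma tswapE M N x y : tswap M N (tens x y) = tens y x.
Proof. by rewrite /tswap; case: cid => h /= ->. Qed.

Lemma tswapK M N : cancel (tswap M N) (tswap N M).
Proof.
move=> z; apply: (@tensor_ext _ _ _ (comp_lin (tswap N M) (tswap M N)) (id_lin _)).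
by move=> x y /=; rewrite !tswapE.
Qed.

Lemma tswap_mapl M M' N (f : {linear M -> M'}) z :
  tswap M' N (tmapl N f z) = tmapr N f (tswap M N z).
Proof.
apply: (@tensor_ext _ _ _ (comp_lin (tswap M' N) (tmapl N f))
                   (comp_lin (tmapr N f) (tswap M N))) => x y /=.
by rewrite !(tswapE, tmapE).
Qed.

Lemma tswap_mapr M N N' (g : {linear N -> N'}) z :
  tswap M N' (tmapr M g z) = tmapl M g (tswap M N z).
Proof.
apply: (@tensor_ext _ _ _ (comp_lin (tswap M N') (tmapr M g))
                   (comp_lin (tmapl M g) (tswap M N))) => x y /=.
by rewrite !(tswapE, tmapE).
Qed.

Lemma tmapl_surj M M' N (f : {linear M -> M'}) :
  (forall y, exists x, f x = y) -> forall z, exists u, tmapl N f u = z.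
Proof.
move=> fs; elim/tensor_ind => [_ _ [u <-] [v <-]|x y].
  by exists (u + v); rewrite linearD.
by have [w <-] := fs x; exists (tens w y); rewrite tmapE.
Qed.

(* The inverse of (G (x) X) / im (L (x) X) -> Y (x) X is induced by
   (y, x) |-> [g (x) x] for any lift g of y. *)
Lemma tmapl_exact L G Y X (i : {linear L -> G}) (p : {linear G -> Y}) :
  exact_at i p -> (forall y, exists g, p g = y) ->
  forall u, tmapl X p u = 0 -> exists t, tmapl X i t = u.
Proof.
move=> ex ps.
have [Q [q [qs hq]]] := ex_quotient (im_subspace (tmapl X i)).
have /choice[s hs] := ps.
have E g x : q (tens (s (p g)) x) = q (tens g x).
  apply/subr0_eq; rewrite -linearB; apply/hq.
  have [l hl] : exists l, i l = s (p g) - g by apply/ex; rewrite linearB hs subrr.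
  exists (tens l x); rewrite tmapE hl /=.
  by rewrite -[in RHS](subrK g (s (p g))) [in RHS]tensDl addrK.
have [||||h hE _] := @tensor_lift R Y X Q (fun y x => q (tens (s y) x)).
- by move=> y y' x; rewrite -(linearD q) -tensDl -[in RHS]E linearD !hs.
- by move=> y x x'; rewrite tensDr linearD.
- by move=> a y x; rewrite -[in LHS](hs y) -[in LHS]linearZ E tensZl linearZ.
- by move=> a y x; rewrite tensZr linearZ.
move=> u hu; apply/hq.
have <- : h (tmapl X p u) = q u.
  apply: (@tensor_ext _ _ _ (comp_lin h (tmapl X p)) q) => g x /=.
  by rewrite tmapE hE E.
by rewrite hu linear0.
Qed.

Lemma tmapr_exact Y K F X (i : {linear K -> F}) (p : {linear F -> X}) :
  exact_at i p -> (forall y, exists g, p g = y) ->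
  forall u, tmapr Y p u = 0 -> exists t, tmapr Y i t = u.
Proof.
move=> ex ps u hu.
have [|t ht] := tmapl_exact ex ps (X := Y) (u := tswap _ _ u).
  by rewrite -tswap_mapr hu linear0.
by exists (tswap _ _ t); rewrite -tswap_mapl ht tswapK.
Qed.

Lemma tmapr_ses0 U V W Y (i : {linear U -> V}) (p : {linear V -> W}) z :
  ses i p -> tmapr Y p (tmapr Y i z) = 0.
Proof.
move=> h; rewrite (@tmapr_comp _ _ _ _ _ _ (comp_lin p i)) //.
by apply: tmapr0 => x /=; rewrite (ses0 _ h).
Qed.

Lemma tmapl_ses0 U V W Y (i : {linear U -> V}) (p : {linear V -> W}) z :
  ses i p -> tmapl Y p (tmapl Y i z) = 0.
Proof.
move=> h; apply: (can_inj (@tswapK _ _)).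
by rewrite !tswap_mapl (tmapr_ses0 _ h) linear0.
Qed.

Definition flat F := forall L G (i : {linear L -> G}),
  injective i -> injective (tmapl F i).

Lemma flatr F L G (i : {linear L -> G}) : flat F -> injective i -> injective (tmapr F i).
Proof.
move=> hF /hF iI u v huv; apply/(can_inj (@tswapK _ _))/iI.
by rewrite -!tswap_mapr huv.
Qed.

Lemma flat_retract F P (s : {linear P -> F}) (r : {linear F -> P}) :
  cancel s r -> flat F -> flat P.
Proof.
move=> sK hF L G i iI; apply: lin_inj => z hz.
suff : tmapr L s z = 0.
  move=> /(congr1 (tmapr L r)); rewrite linear0 => <-.
  rewrite (@tmapr_comp _ _ _ _ _ _ (id_lin P)) //.
  by rewrite tmapr_id.
by apply: (hF _ _ _ iI); rewrite tmaplr hz !linear0.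
Qed.

(** The coordinate maps L (x) F -> L are natural in L, and a tensor is recovered from finitely many
    coordinates. So injectivity of [i] on coordinates gives injectivity on L (x) F. *)
Lemma free_flat (S : choiceType) (F := {freeg S / R} : lmodType R) : flat F.
Proof.
have cL s : linear (coeff s : F -> R^o).
  by move=> a x y; rewrite coeffD coeffZ.
have cmP L (s : S) : exists c : {linear tensor L F -> L},
    forall x f, c (tens x f) = coeff s f *: x.
  have [||||c hc _] := @tensor_lift R L F L (fun x f => coeff s f *: x).
  - by move=> x x' f; rewrite scalerDr.
  - by move=> x f f'; rewrite coeffD scalerDl.
  - by move=> a x f; rewrite !scalerA mulrC.
  - by move=> a x f; rewrite coeffZ scalerA.
  by exists c.
pose c L s := projT1 (cid (cmP L s)).
have cE L s x f : c L s (tens x f) = coeff s f *: x.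
  by rewrite /c; case: cid => ? /= ->.
(* The expansion is asked over every larger duplicate-free list, so that two tensors can be expanded
   over a common one. *)
have cS L (z : tensor L F) : exists r : seq S, forall r', {subset r <= r'} ->
    uniq r' -> z = \sum_(s <- r') tens (c L s z) (<< s >> : F).
  elim/tensor_ind: z => [u v [r hr] [r2 hr2]|x f].
    exists (r ++ r2) => r' sr ur.
    have eu := hr r' (fun t ht => sr t (mem_subseq (prefix_subseq r r2) ht)) ur.
    have ev := hr2 r' (fun t ht => sr t (mem_subseq (suffix_subseq r r2) ht)) ur.
    transitivity (\sum_(s <- r') tens (c L s u) (<< s >> : F) +
                  \sum_(s <- r') tens (c L s v) (<< s >> : F)).
      by congr (_ + _).
    by rewrite -big_split; apply: eq_bigr => s _; rewrite linearD tensDl.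
  exists (dom f) => r' sr ur.
  transitivity (tens x (\sum_(s <- r') coeff s f *: (<< s >> : F))).
    congr tens; apply/eqP/freeg_eqP => k; rewrite raddf_sum /=.
    under eq_bigr do rewrite coeffZ coeffU mul1r.
    have [kr|kr] := boolP (k \in r').
      by rewrite (bigD1_seq k) //= eqxx mulr1 big1 ?addr0 // => s /negPf->; rewrite mulr0.
    rewrite big1_seq ?coeff_outdom //; first by apply: contra kr; apply: sr.
    by move=> s /= sr'; rewrite (_ : s == k = false) ?mulr0 //; apply: contraNF kr => /eqP <-.
  have tL : linear (tens x : F -> tensor L F).
    by move=> a y y'; rewrite tensDr tensZr.
  rewrite -[LHS]/(mklin tL _) linear_sum; apply: eq_bigr => s _ /=.
  by rewrite tensZr -tensZl cE.
move=> L G i iI; apply: lin_inj => z hz.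
have [r /(_ (undup r))] := cS L z; rewrite undup_uniq => -> //; last first.
  by move=> s; rewrite mem_undup.
apply: big1 => s _.
suff -> : c L s z = 0 by rewrite -(scale0r 0) tensZl scale0r.
apply: iI; rewrite linear0.
have <- : c G s (tmapl F i z) = i (c L s z).
  apply: (@tensor_ext _ _ _ (comp_lin (c G s) (tmapl F i)) (comp_lin i (c L s))).
  by move=> x f /=; rewrite tmapE !cE linearZ.
by rewrite hz linear0.
Qed.

Lemma free_cover X : exists (F : lmodType R) (p : {linear F -> X}),
  flat F /\ forall x, exists f, p f = x.
Proof.
pose p : {freeg X / R} -> X := fglift id.
have pB : zmod_morphism p by exact: lift_is_additive.
pose pa : {additive {freeg X / R} -> X} := HB.pack p (GRing.isZmodMorphism.Build _ _ p pB).
have pU k x : p << k *g x >> = k *: x by rewrite /p liftU.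
have pD u v : p (u + v) = p u + p v by exact: (raddfD pa).
have pZ : scalable p.
  move=> a z; rewrite -(freeg_sumE z) scaler_sumr.
  rewrite ![p _](raddf_sum pa) scaler_sumr; apply: eq_bigr => k _.
  have -> : a *: << coeff k z *g k >> = << a * coeff k z *g k >> :> {freeg X / R}.
    by apply/eqP/freeg_eqP => k'; rewrite coeffZ !coeffU mulrA.
  by rewrite /= !pU scalerA.
have pL : linear p by move=> a y z; rewrite pD pZ.
exists ({freeg X / R} : lmodType R), (mklin pL); split; first exact: free_flat.
by move=> x; exists << x >>; rewrite /= pU scale1r.
Qed.

Lemma free_pres X : exists (K F : lmodType R) (i : {linear K -> F}) (p : {linear F -> X}),
  flat F /\ ses i p.
Proof.
have [F [p [hF ps]]] := free_cover X.
by have [K [i hs]] := ex_ker ps; exists K, F, i, p.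
Qed.

Lemma projective_flat P : projective P -> flat P.
Proof.
move=> hP; have [F [p [hF ps]]] := free_cover P.
have [s hs] := hP _ _ p (id_lin P) ps.
exact: (@flat_retract F P s p).
Qed.

End TensorFunctor.

(** * Vanishing and torsion of Tor *)

Section TorVanishing.
Variable R : comNzRingType.
Implicit Types (L G Y Z K F X M N P U V W : lmodType R) (x : R).

Definition tors_elt x X (z : X) := exists n : nat, x ^+ n *: z = 0.

(** Injectivity up to [x]-power torsion; by [tors_elt1] the case [x] = 1 is plain injectivity. *)
Definition ker_tors x U V (f : {linear U -> V}) := forall z, f z = 0 -> tors_elt x z.

Lemma tors_elt0 x X : tors_elt x (0 : X).
Proof. by exists 0%N; rewrite scaler0. Qed.

Lemma tors_eltD x X (y z : X) : tors_elt x y -> tors_elt x z -> tors_elt x (y + z).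
Proof.
move=> [n hn] [k hk]; exists (n + k)%N.
by rewrite scalerDr {1}addnC !exprD -!scalerA hn hk !scaler0 addr0.
Qed.

Lemma tors_elt_iter x X n (z : X) : tors_elt x (x ^+ n *: z) -> tors_elt x z.
Proof. by move=> [k hk]; exists (k + n)%N; rewrite exprD -scalerA. Qed.

Lemma tors_elt_map x U V (f : {linear U -> V}) z : tors_elt x z -> tors_elt x (f z).
Proof. by move=> [n hn]; exists n; rewrite -linearZ hn linear0. Qed.

Lemma tors_elt_inj x U V (f : {linear U -> V}) z :
  injective f -> tors_elt x (f z) -> tors_elt x z.
Proof. by move=> fI [n hn]; exists n; apply: fI; rewrite linearZ /= hn linear0. Qed.

Lemma tors_elt1 X (z : X) : tors_elt 1 z <-> z = 0.
Proof.
split=> [[n]|->]; last exact: tors_elt0.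
by rewrite expr1n scale1r.
Qed.

Lemma inj_ker_tors x U V (f : {linear U -> V}) : injective f -> ker_tors x f.
Proof.
move=> fI z hz; have -> : z = 0 by apply: fI; rewrite hz linear0.
exact: tors_elt0.
Qed.

(* A snake lemma chase in the 3x3 diagram of L -> G -> Y tensored with K -> F -> X. *)
Lemma tor_chase x L G Y K F X (iL : {linear L -> G}) (pG : {linear G -> Y})
    (iK : {linear K -> F}) (pF : {linear F -> X}) :
  ses iL pG -> ses iK pF ->
  ker_tors x (tmapl X iL) -> ker_tors x (tmapr G iK) -> ker_tors x (tmapr Y iK).
Proof.
move=> sL sK tL tG w hw.
have [_ eL pGs] := sL; have [_ eK pFs] := sK.
have [u hu] := tmapl_surj pGs w.
have [|v hv] := tmapl_exact eL pGs (u := tmapr G iK u).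
  by rewrite tmaplr hu hw.
have [n hn] : tors_elt x (tmapr L pF v).
  by apply: tL; rewrite tmaplr hv (tmapr_ses0 _ sK).
have [|t ht] := tmapr_exact eK pFs (u := x ^+ n *: v) (Y := L).
  by rewrite linearZ /= hn.
have h0 : tmapr G iK (x ^+ n *: u - tmapl K iL t) = 0.
  by rewrite linearB linearZ -hv -tmaplr ht linearZ subrr.
have := tors_elt_map (tmapl K pG) (tG _ h0).
rewrite linearB linearZ hu (tmapl_ses0 _ sL) subr0.
exact: tors_elt_iter.
Qed.

Lemma ker_tors_swapl x L G X (i : {linear L -> G}) :
  ker_tors x (tmapl X i) <-> ker_tors x (tmapr X i).
Proof.
split=> h z hz; apply: (tors_elt_inj (can_inj (@tswapK _ _ _))); apply: h.
  by rewrite -tswap_mapr hz linear0.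
by rewrite -tswap_mapl hz linear0.
Qed.

(* tor1_tors x Y X: every element of Tor_1(Y, X) is killed by a power of x. *)
Definition tor1_tors x Y X := forall K F (i : {linear K -> F}) (p : {linear F -> X}),
  ses i p -> ker_tors x (tmapr Y i).

(** A single presentation of [Y] tests all sequences ending in [X]: flatness of [G] supplies the
    missing hypothesis of [tor_chase]. *)
Lemma tor1_tors_left x L G Y X (i : {linear L -> G}) (p : {linear G -> Y}) :
  ses i p -> flat G -> ker_tors x (tmapl X i) -> tor1_tors x Y X.
Proof.
move=> s fG h K F iK pF sK; apply: (tor_chase s sK h).
by apply/inj_ker_tors/flatr => //; case: sK.
Qed.

(** The transposed chase, with a free presentation of [X]. Here the middle term [G] may be
    arbitrary, which is what yields the symmetry [tor1_torsC]. *)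
Lemma tor1_tors_leftE x L G Y X (i : {linear L -> G}) (p : {linear G -> Y}) :
  tor1_tors x Y X -> ses i p -> ker_tors x (tmapl X i).
Proof.
move=> h s; have [K [F [iK [pF [fF sK]]]]] := free_pres X.
apply/ker_tors_swapl; apply: (tor_chase sK s).
  exact/ker_tors_swapl/(h _ _ _ _ sK).
by apply/inj_ker_tors/flatr => //; case: s.
Qed.

Lemma tor1_tors_right x Y K F X (i : {linear K -> F}) (p : {linear F -> X}) :
  ses i p -> flat F -> ker_tors x (tmapr Y i) -> tor1_tors x Y X.
Proof.
move=> s fF h; have [L [G [iL [pG [fG sL]]]]] := free_pres Y.
apply: (tor1_tors_left sL fG); apply/ker_tors_swapl; apply: (tor_chase s sL).
  exact/ker_tors_swapl.
by apply/inj_ker_tors/flatr => //; case: sL.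
Qed.

Lemma tor1_torsC x Y X : tor1_tors x Y X -> tor1_tors x X Y.
Proof.
move=> h L G i p s; apply/ker_tors_swapl; exact: tor1_tors_leftE h s.
Qed.

(** Both sides describe the kernel of L (x) K -> G (x) F, classically Tor_2(Y, X): by flatness G (x)
    K -> G (x) F and L (x) F -> G (x) F are injective. *)
Lemma tor1_tors_shift x L G Y K F X (iL : {linear L -> G}) (pG : {linear G -> Y})
    (iK : {linear K -> F}) (pF : {linear F -> X}) :
  ses iL pG -> flat G -> ses iK pF -> flat F -> tor1_tors x Y K <-> tor1_tors x L X.
Proof.
move=> sL fG sK fF; split=> h.
  apply: (tor1_tors_right sK fF) => z hz; apply: (tor1_tors_leftE h sL).
  apply: (flatr fG (i := iK)); first by case: sK.
  by rewrite -tmaplr hz !linear0.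
apply: (tor1_tors_left sL fG) => z hz; apply: (h _ _ _ _ sK).
apply: (fF _ _ iL); first by case: sL.
by rewrite tmaplr hz !linear0.
Qed.

(* tor_tors x n Y X: every element of Tor_(n+1)(Y, X) is killed by a power of x; for
   x = 1 this says that Tor_(n+1)(Y, X) = 0. *)
Fixpoint tor_tors x (n : nat) Y X : Prop :=
  if n is n'.+1 then
    forall K F (i : {linear K -> F}) (p : {linear F -> X}),
      ses i p -> flat F -> tor_tors x n' Y K
  else tor1_tors x Y X.

Lemma tor_tors_shiftl x n L G Y X (i : {linear L -> G}) (p : {linear G -> Y}) :
  ses i p -> flat G -> tor_tors x n.+1 Y X <-> tor_tors x n L X.
Proof.
move=> s fG; elim: n X => [|n IH] X; split=> h.
- have [K [F [iK [pF [fF sK]]]]] := free_pres X.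
  by apply: (proj1 (tor1_tors_shift x s fG sK fF)); apply: (h _ _ _ _ sK fF).
- by move=> K F iK pF sK fF; apply: (proj2 (tor1_tors_shift x s fG sK fF)).
- by move=> K F iK pF sK fF; apply/IH; apply: (h _ _ _ _ sK fF).
by move=> K F iK pF sK fF; apply/IH; apply: (h _ _ _ _ sK fF).
Qed.

(** The definition of [tor_tors] ranges over all flat presentations of [X]. One suffices, because a
    degree can be moved over to a presentation of [Y], where the induction applies, and back. *)
Lemma tor_tors_shiftr x n Y K F X (i : {linear K -> F}) (p : {linear F -> X}) :
  ses i p -> flat F -> tor_tors x n.+1 Y X <-> tor_tors x n Y K.
Proof.
move=> s fF; split=> [h|]; first exact: h s fF.
elim: n Y => [|n IH] Y h; have [L [G [iL [pG [fG sL]]]]] := free_pres Y.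
  by apply/(tor_tors_shiftl _ 0 _ sL fG)/(tor1_tors_shift x sL fG s fF).
apply/(tor_tors_shiftl _ n.+1 _ sL fG)/IH.
exact/(tor_tors_shiftl _ n _ sL fG).
Qed.

Lemma tor_torsC x n Y X : tor_tors x n Y X -> tor_tors x n X Y.
Proof.
elim: n X => [|n IH] X h; first exact: tor1_torsC.
have [K [F [i [p [fF s]]]]] := free_pres X.
by apply/(tor_tors_shiftl _ n _ s fF)/IH/(tor_tors_shiftr _ n _ s fF).
Qed.

(** * The long exact sequence of Tor in the first variable, for torsion *)

Section LongExactSequence.
Variables (Y' Y Y'' : lmodType R) (i : {linear Y' -> Y}) (p : {linear Y -> Y''}).
Hypothesis s : ses i p.

Lemma tor_tors_mid x n X : tor_tors x n Y' X -> tor_tors x n Y'' X -> tor_tors x n Y X.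
Proof.
elim: n X => [|n IH] X h' h''; have [K [F [iK [pF [fF sK]]]]] := free_pres X.
  have [_ e ps] := s; apply: (tor1_tors_right sK fF) => z hz.
  have [k hk] : tors_elt x (tmapl K p z).
    by apply: (h'' _ _ _ _ sK); rewrite -tmaplr hz linear0.
  have [|t ht] := tmapl_exact e ps (u := x ^+ k *: z); first by rewrite linearZ.
  apply: (@tors_elt_iter _ _ k); rewrite -ht; apply: tors_elt_map.
  apply: (h' _ _ _ _ sK); apply: (fF _ _ i); first by case: s.
  by rewrite tmaplr ht linearZ /= hz scaler0 linear0.
by apply/(tor_tors_shiftr _ _ _ sK fF)/IH; apply/(tor_tors_shiftr _ _ _ sK fF).
Qed.

Lemma tor_tors_left x n X : tor_tors x n Y X -> tor_tors x n.+1 Y'' X -> tor_tors x n Y' X.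
Proof.
elim: n X => [|n IH] X h h''; have [K [F [iK [pF [fF sK]]]]] := free_pres X.
  apply: (tor1_tors_right sK fF) => z hz.
  have [k hk] : tors_elt x (tmapl K i z).
    by apply: (h _ _ _ _ sK); rewrite -tmaplr hz linear0.
  apply: (@tors_elt_iter _ _ k); apply: (tor1_tors_leftE (h'' _ _ _ _ sK fF) s).
  by rewrite linearZ.
by apply/(tor_tors_shiftr _ _ _ sK fF)/IH; apply/(tor_tors_shiftr _ _ _ sK fF).
Qed.

Lemma tor_tors_right x n X : tor_tors x n.+1 Y X -> tor_tors x n Y' X -> tor_tors x n.+1 Y'' X.
Proof.
elim: n X => [|n IH] X h h'; have [K [F [iK [pF [fF sK]]]]] := free_pres X.
  (* The lowest case already concerns Tor_2, so a second presentation, of [K], is needed before the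
     chase applies. *)
  apply/(tor_tors_shiftr _ 0 _ sK fF); have [K2 [F2 [i2 [p2 [fF2 s2]]]]] := free_pres K.
  apply: (tor1_tors_right s2 fF2); apply: (tor_chase s s2).
    move=> z hz; apply: (h' _ _ _ _ sK); apply: (fF _ _ i); first by case: s.
    by rewrite tmaplr hz !linear0.
  by have /(tor_tors_shiftr _ 0 _ sK fF) := h; apply; exact: s2.
by apply/(tor_tors_shiftr _ _ _ sK fF)/IH; apply/(tor_tors_shiftr _ _ _ sK fF).
Qed.

End LongExactSequence.

Lemma tor_tors_flatl x n Y X : flat Y -> tor_tors x n Y X.
Proof.
move=> fY; elim: n X => [|n IH] X; last by move=> K F i p s fF; apply: IH.
by move=> K F i p s; apply/inj_ker_tors/flatr => //; case: s.
Qed.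

Lemma tor_tors_zero x n Y X : (forall y : Y, y = 0) -> tor_tors x n Y X.
Proof.
move=> Y0; apply: tor_tors_flatl => L G i iI; apply: lin_inj => z _.
elim/tensor_ind: z => [u v -> ->|l y]; first exact: addr0.
by rewrite (Y0 y) -(scale0r 0) tensZr scale0r.
Qed.

Lemma tor_tors_tors x n Y X : (forall z : X, tors_elt x z) -> tor_tors x n Y X.
Proof.
move=> hX; elim: n Y => [|n IH] Y; have [L [G [i [p [fG s]]]]] := free_pres Y.
  apply: (tor1_tors_left s fG) => z _.
  elim/tensor_ind: z => [u v|l y]; first exact: tors_eltD.
  by have [k hk] := hX y; exists k; rewrite -tensZr hk -(scale0r 0) tensZr scale0r.
exact/(tor_tors_shiftl _ n _ s fG)/IH.
Qed.

(* Multiplication by x is injective on Tor_(n+1)(Y, X) as soon as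
   Tor_(n+2)(Y/xY, X) = 0, while Tor(Y, X) inherits torsion from X. *)
Lemma tor_tors_regular_tors x n Y Z X (p : {linear Y -> Z}) :
  (forall z : X, tors_elt x z) -> ses (scale_lin Y x) p ->
  tor_tors 1 n.+1 Z X -> tor_tors 1 n Y X.
Proof.
move=> hX s hZ; have {hX} := tor_tors_tors n Y hX.
elim: n X hZ => [|n IH] X hZ hT; have [K [F [iK [pF [fF sK]]]]] := free_pres X.
  apply: (tor1_tors_right sK fF) => z hz; have [k hk] := hT _ _ _ _ sK _ hz.
  exists 0%N; rewrite scale1r.
  (* Multiplication by [x] is injective on the kernel, so the factors of [x ^+ k] are removed one by
     one. *)
  elim: k hk => [|k IHk]; first by rewrite scale1r.
  rewrite exprS -scalerA => hk; apply: IHk; apply/tors_elt1.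
  apply: (tor1_tors_leftE (hZ _ _ _ _ sK fF) s).
  suff -> : tmapl K (scale_lin Y x) (x ^+ k *: z) = x *: (x ^+ k *: z) by [].
  apply: (@tensor_ext _ _ _ _ _ (scale_lin _ x)) => y u.
  by rewrite tmapE /= tensZl.
apply/(tor_tors_shiftr _ _ _ sK fF)/IH; exact/(tor_tors_shiftr _ _ _ sK fF).
Qed.

(** A tensor is again the finite sum of its components. Asking for the expansion at all [l >= k]
    lets the bounds of two summands be merged by [maxn]. *)
Lemma tensor_direct_sum Y X (XS : nat -> lmodType R) (io : forall j, {linear XS j -> X})
    (pr : forall j, {linear X -> XS j}) :
  (forall z : X, exists k, forall l, (k <= l)%N ->
     z = \sum_(j < l) io j (pr j z)) ->
  forall u : tensor Y X, (forall j, tmapr Y (pr j) u = 0) -> u = 0.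
Proof.
move=> hX u hu.
have [k /(_ k (leqnn k)) ->] : exists k, forall l, (k <= l)%N ->
    u = \sum_(j < l) tmapr Y (io j) (tmapr Y (pr j) u).
  elim/tensor_ind: u {hu} => [u v [k hk] [k2 hk2]|y z].
    exists (maxn k k2) => l; rewrite geq_max => /andP[kl k2l].
    rewrite [in LHS](hk _ kl) [in LHS](hk2 _ k2l) -big_split.
    by apply: eq_bigr => j _; rewrite !linearD.
  have [k hk] := hX z; exists k => l kl.
  have tL : linear (tens y : X -> tensor Y X) by move=> a t t'; rewrite tensDr tensZr.
  rewrite [in LHS](hk _ kl) -[LHS]/(mklin tL _) linear_sum.
  by apply: eq_bigr => j _; rewrite !tmapE.
by apply: big1 => j _; rewrite hu linear0.
Qed.

Lemma tor_tors_direct_sum n Y X (XS : nat -> lmodType R) (io : forall j, {linear XS j -> X})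
    (pr : forall j, {linear X -> XS j}) :
  (forall z : X, exists k, forall l, (k <= l)%N ->
     z = \sum_(j < l) io j (pr j z)) ->
  (forall j, tor_tors 1 n Y (XS j)) -> tor_tors 1 n Y X.
Proof.
move=> hX; elim: n Y => [|n IH] Y h; have [L [G [i [p [fG s]]]]] := free_pres Y.
  apply: (tor1_tors_left s fG) => z hz; apply/tors_elt1.
  apply: (tensor_direct_sum hX) => j; apply/tors_elt1.
  by apply: (tor1_tors_leftE (h j) s); rewrite tmaplr hz linear0.
apply/(tor_tors_shiftl _ n _ s fG)/IH => j; exact/(tor_tors_shiftl _ n _ s fG).
Qed.

(** Removing P_0 leaves a syzygy with a resolution shorter by one. At length 0 the map [e] is an
    isomorphism, and [X] is a retract of a flat module. *)
Lemma tor_tors_resolution X n j Y : has_proj_resolution X n -> (n <= j)%N -> tor_tors 1 j Y X.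
Proof.
elim: n X j => [|n IH] X j [P [d [e [Pp es e0 ei Pz]]]].
  move=> _; apply: tor_torsC; apply: tor_tors_flatl.
  have eI : injective e.
    apply: lin_inj => v /e0[u <-]; rewrite (Pz 1%N isT u) linear0 //.
  have [g hg] := lin_lift_inj (f := id_lin X) eI es.
  have fP := projective_flat (Pp 0%N).
  by apply: (@flat_retract _ _ _ g e).
case: j => // j nj; have [K [i s]] := ex_ker es.
have fP := projective_flat (Pp 0%N).
apply/(tor_tors_shiftr _ _ _ s fP)/IH => //.
have [iI eK _] := s.
have [|g hg] := lin_lift_inj (f := d 0%N) iI; first by move=> w; apply/eK/e0; exists w.
exists (fun k => P k.+1), (fun k => d k.+1), g; split=> //.
- move=> k; have /e0[u hu] := (ses0 k s); exists u; apply: iI.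
  by rewrite hg hu.
- move=> v; split=> [h|[u hu]]; first by apply/ei; rewrite -hg h linear0.
  by apply: iI; rewrite hg linear0; apply/ei; exists u.
by move=> k nk z; apply: Pz.
Qed.

End TorVanishing.

(** * Noetherian ideals and regular sequences *)

Lemma enat_inf_some (S : nat -> Prop) d :
  enat_inf S = Some d -> S d /\ forall k, S k -> (d <= k)%N.
Proof.
rewrite /enat_inf; case: pselect => // h [<-]; case: ex_minnP => k /asboolP hk kmin.
by split=> // l hl; apply/kmin/asboolP.
Qed.

Lemma enat_inf_none (S : nat -> Prop) : enat_inf S <> None -> exists d, S d.
Proof. by rewrite /enat_inf; case: pselect => // -[d /asboolP h] _; exists d. Qed.

(** A finite supremum is attained unless it is 0, the value that [enat_sup] also gives to the empty
    set. *)
Lemma enat_sup_some (S : nat -> Prop) d :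
  enat_sup S = Some d -> (forall k, S k -> (k <= d)%N) /\ ((0 < d)%N -> S d).
Proof.
move=> /enat_inf_some[ub lub]; split=> // d0.
have [//|nS] := EM (S d).
suff /lub : forall k, S k -> (k <= d.-1)%N by rewrite leqNgt prednK ?leqnn.
move=> k hk; have := ub k hk; rewrite leq_eqVlt => /orP[/eqP E|]; first by rewrite E in hk.
by case: d d0 {ub lub nS}.
Qed.

Lemma enat_sup_le (S S' : nat -> Prop) :
  (forall k, S k -> S' k) -> enat_le (enat_sup S) (enat_sup S').
Proof.
move=> h; case E' : (enat_sup S') => [d'|]; last by case: (enat_sup S).
have [/= ub _] := enat_inf_some E'.
case E : (enat_sup S) => [d|] /=.
  by apply: (enat_inf_some E).2 => k /h/ub.
move: E; rewrite /enat_sup /enat_inf; case: pselect => // hn _.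
by case: hn; exists d'; apply/asboolP => k /h/ub.
Qed.

Section Ideals.
Variable A : comNzRingType.
Implicit Types (J K : A -> Prop) (a b c x y z : A).

(** This is [subspace] on [A^o] up to conversion, so [endo_sum_subspace] proves it directly. Unlike
    [idealr], it admits the unit ideal. *)
Definition idl J := J 0 /\ forall a x y, J x -> J y -> J (a * x + y).

Lemma idlM J a x : idl J -> J x -> J (a * x).
Proof. by move=> [h0 h] hx; rewrite -[_ * _]addr0; apply: h. Qed.
Lemma idl_sum J (T : eqType) (s : seq T) (F : T -> A) :
  idl J -> (forall t, t \in s -> J (F t)) -> J (\sum_(t <- s) F t).
Proof. by move=> hJ; exact: (@subspace_sum_seq A A^o J hJ T s F). Qed.

Lemma idl_idealr J : idl J -> ~ J 1 -> exists P : idealr A, forall a, a \in P <-> J a.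
Proof.
move=> [J0 JD] J1; pose P : {pred A} := [pred a | `[< J a >]].
have PP : idealr_closed P.
  split=> [||a x y /asboolP hx /asboolP hy]; [exact/asboolP | exact/asboolP|].
  by apply/asboolP/JD.
exists (HB.pack_for (idealr A) P (isIdealr.Build A P PP)) => a.
by split=> [/asboolP|h] //; apply/asboolP.
Qed.

Lemma idealr_idl (P : idealr A) : idl (fun a => a \in P).
Proof.
split=> [|a x y hx hy]; first exact: idealr0.
by apply: rpredD => //; apply: idealMr.
Qed.

Lemma idl_prime J : idl J -> ~ J 1 -> (forall x y, J (x * y) -> J x \/ J y) ->
  exists P : prime_idealr A, forall a, a \in P <-> J a.
Proof.
move=> [J0 JD] J1 Jp; pose P : {pred A} := [pred a | `[< J a >]].
have PP : idealr_closed P.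
  split=> [||a x y /asboolP hx /asboolP hy]; [exact/asboolP | exact/asboolP|].
  by apply/asboolP/JD.
have Pp : prime_idealr_closed P.
  by move=> x y /asboolP/Jp[h|h]; apply/orP; [left|right]; apply/asboolP.
exists (HB.pack_for (prime_idealr A) P (isIdealr.Build A P PP)
         (isPrimeIdealrClosed.Build A P Pp)) => a.
by split=> [/asboolP|h] //; apply/asboolP.
Qed.

Hypothesis noeth : noetherian A.

Lemma idl_fg J : idl J -> exists s : seq A,
  (forall x, x \in s -> J x) /\
  forall a, J a -> exists c : nat -> A, a = \sum_(i < size s) c i * s`_i.
Proof.
(* [noeth] speaks of proper ideals only, so the unit ideal is treated apart. *)
move=> hJ; have [J1|J1] := EM (J 1).
  exists [:: 1]; split=> [x|a _]; first by rewrite inE => /eqP->.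
  by exists (fun=> a); rewrite big_ord1 mulr1.
have [P hP] := idl_idealr hJ J1; have [s hs] := noeth P; exists s; split.
  move=> x xs; apply/hP; rewrite hs; apply/asboolP.
  exists (fun i => (i == index x s)%:R).
  have ls : (index x s < size s)%N by rewrite index_mem.
  rewrite (bigD1 (Ordinal ls)) //= eqxx scale1r nth_index // big1 ?addr0 // => i ni.
  by rewrite -[(i : nat) == _]/(i == Ordinal ls) (negPf ni) scale0r.
by move=> a /hP; rewrite hs => /asboolP.
Qed.

(** Otherwise choice produces a strictly ascending chain in [Q]; its union is finitely generated and
    hence already equal to a member of the chain. *)
Lemma idl_max (Q : (A -> Prop) -> Prop) :
  (forall J, Q J -> idl J) -> (exists J, Q J) ->
  exists2 J, Q J & forall K, Q K -> (forall a, J a -> K a) -> forall a, K a -> J a.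
Proof.
move=> hQ [J0 QJ0]; apply/not_exists2P => no.
have step (J : {J | Q J}) : exists K : {J | Q J},
    (forall a, sval J a -> sval K a) /\ exists2 a, sval K a & ~ sval J a.
  have /existsNP[K] : ~ forall K, Q K -> (forall a, sval J a -> K a) ->
      forall a, K a -> sval J a.
    by case: (no (sval J)) => // nQ; case: nQ; exact: (svalP J).
  move=> /not_implyP[QK] /not_implyP[sub] /existsNP[a /not_implyP[Ka Ja]].
  by exists (exist _ K QK); split=> //; exists a.
have [f hf] := choice step.
pose u n := iter n f (exist _ J0 QJ0).
have uI n : idl (sval (u n)) by apply/hQ/svalP.
have uS n a : sval (u n) a -> sval (u n.+1) a by apply: (hf (u n)).1.
have um n k a : (n <= k)%N -> sval (u n) a -> sval (u k) a.
  by move=> /subnKC <-; elim: (k - n)%N => [|l IH]; rewrite ?addn0 // addnS => /IH/uS.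
pose U a := exists n, sval (u n) a.
have UI : idl U.
  split=> [|a x y [n hx] [k hy]]; first by exists 0%N; case: (uI 0%N).
  exists (maxn n k); apply: (uI _).2; first by apply: um hx; exact: leq_maxl.
  by apply: um hy; exact: leq_maxr.
have [s [sU sg]] := idl_fg UI.
have [n hn] : exists n, forall x, x \in s -> sval (u n) x.
  elim: s sU {sg} => [|y s IH] sU; first by exists 0%N.
  have [n hn] := IH (fun x hx => sU x (mem_behead (s := y :: s) hx)).
  have [k hk] := sU y (mem_head _ _).
  exists (maxn n k) => x; rewrite inE => /orP[/eqP->|/hn hx].
    by apply: um hk; exact: leq_maxr.
  by apply: um hx; exact: leq_maxl.
have [_ [a ha []]] := hf (u n).
have [|c ->] := sg a; first by exists n.+1.
by apply: idl_sum => // i _; apply: idlM => //; apply/hn/mem_nth.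
Qed.

(** An ideal maximal among those that contain [J] and miss [S] is prime; [idl_max] takes the place
    of Zorn's lemma. *)
Lemma krull J (S : A -> Prop) :
  idl J -> S 1 -> (forall x y, S x -> S y -> S (x * y)) -> (forall a, J a -> ~ S a) ->
  exists P : prime_idealr A, (forall a, J a -> a \in P) /\ (forall a, S a -> a \notin P).
Proof.
move=> hJ S1 SM JS.
have [||K [KI JK KS] Kmax] := @idl_max (fun K => [/\ idl K, forall a, J a -> K a
     & forall a, K a -> ~ S a]).
- by move=> K [].
- by exists J.
have ext x : ~ K x -> exists k c, K k /\ S (k + c * x).
  move=> Kx; apply: contrapT => no; apply: Kx.
  apply: (Kmax (fun z => exists k c, K k /\ z = k + c * x)).
  - split.
    + split=> [|a _ _ [k [c [Kk ->]]] [k' [c' [Kk' ->]]]].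
        by exists 0, 0; split; [case: KI | rewrite mul0r addr0].
      by exists (a * k + k'), (a * c + c'); split; [apply: KI.2 | ring].
    + by move=> a /JK Ka; exists a, 0; split=> //; rewrite mul0r addr0.
    + by move=> _ [k [c [Kk ->]]] Sk; apply: no; exists k, c.
  - by move=> a Ka; exists a, 0; split=> //; rewrite mul0r addr0.
  - by exists 0, 1; split; [case: KI | rewrite mul1r add0r].
have K1 : ~ K 1 by move/KS.
have Kp x y : K (x * y) -> K x \/ K y.
  move=> Kxy; apply: contrapT => /not_orP[/ext[k [c [Kk Sk]]] /ext[k' [c' [Kk' Sk']]]].
  apply: KS (SM _ _ Sk Sk').
  have -> : (k + c * x) * (k' + c' * y) =
     (k' + c' * y) * k + (c * x * k' + c * c' * (x * y)) by ring.
  by apply: KI.2 => //; apply: KI.2 => //; apply: idlM.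
have [P hP] := idl_prime KI K1 Kp.
exists P; split=> [a /JK /hP //|a Sa]; apply/negP => /hP /KS; exact.
Qed.

End Ideals.

(** * Regular sequences of commuting endomorphisms *)

Section EndoSum.
Variables (R : comNzRingType) (X : lmodType R) (f : nat -> {linear X -> X}).
Hypothesis fC : forall i j x, f i (f j x) = f j (f i x).

Definition endo_sum i (x : X) := exists y : nat -> X, x = \sum_(j < i) f j (y j).

Lemma endo_sum_subspace i : subspace (endo_sum i).
Proof.
split=> [|a _ _ [y ->] [z ->]].
  by exists (fun=> 0); rewrite big1 // => j _; rewrite linear0.
exists (fun j => a *: y j + z j); rewrite scaler_sumr -big_split.
by apply: eq_bigr => j _; rewrite linearP.
Qed.

Lemma endo_sumS i x : endo_sum i.+1 x <-> exists u w, endo_sum i u /\ x = u + f i w.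
Proof.
split=> [[y ->]|[_ [w [[y ->] ->]]]].
  by exists (\sum_(j < i) f j (y j)), (y i); split; [exists y | rewrite big_ord_recr].
exists (fun j => if j == i then w else y j); rewrite big_ord_recr /= eqxx.
by congr (_ + _); apply: eq_bigr => j _; rewrite ltn_eqF.
Qed.

Lemma endo_sum_stable i j x : endo_sum i x -> endo_sum i (f j x).
Proof.
move=> [y ->]; exists (fun k => f j (y k)); rewrite linear_sum.
by apply: eq_bigr => k _; rewrite fC.
Qed.

Definition endo_regular n := forall i, (i < n)%N -> forall x,
  endo_sum i (f i x) -> endo_sum i x.

(** The quotients are specified only by surjections with given kernels, so any model may be used,
    such as the module itself for i = 0. *)
Lemma endo_regular_ses n i (Q Q' : lmodType R) (p : {linear X -> Q}) (p' : {linear X -> Q'}) :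
  endo_regular n -> (i < n)%N ->
  (forall q, exists x, p x = q) -> (forall x, p x = 0 <-> endo_sum i x) ->
  (forall q, exists x, p' x = q) -> (forall x, p' x = 0 <-> endo_sum i.+1 x) ->
  exists (g : {linear Q -> Q}) (h : {linear Q -> Q'}),
  [/\ forall x, g (p x) = p (f i x), forall x, h (p x) = p' x & ses g h].
Proof.
move=> reg lin ps pk ps' pk'.
have [|g hg] := lin_lift_surj (f := comp_lin p (f i)) ps.
  by move=> u /pk hu /=; apply/pk/endo_sum_stable.
have [|h hh] := lin_lift_surj (f := p') ps.
  move=> u /pk hu; apply/pk'/endo_sumS; exists u, 0; split=> //.
  by rewrite linear0 addr0.
exists g, h; split=> //; split=> [|q|q].
- apply: lin_inj => q; have [x <-] := ps q; rewrite hg /= => /pk hx.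
  by apply/pk; apply: (reg i lin).
- have [x <-] := ps q; rewrite hh; split=> [/pk'/endo_sumS[u [w [hu ->]]]|[v]].
    by exists (p w); rewrite hg linearD (proj2 (pk u) hu) add0r.
  have [w <-] := ps v; rewrite hg /= => E.
  have /pk hu : p (x - f i w) = 0 by rewrite linearB E subrr.
  by apply/pk'/endo_sumS; exists (x - f i w), w; rewrite subrK.
have [x <-] := ps' q; by exists (p x).
Qed.

End EndoSum.

Lemma scale_linC (R : comNzRingType) (X : lmodType R) (a : nat -> R) i j x :
  scale_lin X (a i) (scale_lin X (a j) x) = scale_lin X (a j) (scale_lin X (a i) x).
Proof. by rewrite /= !scalerA mulrC. Qed.

Lemma ses_ext (R : comNzRingType) (U V W : lmodType R) (i i' : {linear U -> V})
    (p : {linear V -> W}) : i =1 i' -> ses i p -> ses i' p.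
Proof.
move=> E [iI e ps]; split=> // [x y|v]; first by rewrite -!E => /iI.
by rewrite (e v); split=> -[u <-]; exists u; rewrite E.
Qed.

Lemma scalar_regular_ses (R : comNzRingType) (X : lmodType R) (a : nat -> R) n i (Q Q' : lmodType R)
    (p : {linear X -> Q}) (p' : {linear X -> Q'}) (f := fun j => scale_lin X (a j)) :
  endo_regular f n -> (i < n)%N ->
  (forall q, exists x, p x = q) -> (forall x, p x = 0 <-> endo_sum f i x) ->
  (forall q, exists x, p' x = q) -> (forall x, p' x = 0 <-> endo_sum f i.+1 x) ->
  exists h : {linear Q -> Q'}, ses (scale_lin Q (a i)) h.
Proof.
move=> reg lin ps pk ps' pk'.
have [|g [h [hg _ s]]] := endo_regular_ses _ reg lin ps pk ps' pk'.
  by move=> *; exact: scale_linC.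
exists h; apply: ses_ext s => q; have [x <-] := ps q.
by rewrite hg /= linearZ.
Qed.

(** * Regular sequences, dimension and socles in a local ring *)

Section DepthDim.
Variable A : comNzRingType.
Hypothesis noeth : noetherian A.

(** The chain is built downwards from [P]: below it comes a prime [Q] that contains the ideal of the
    earlier elements but not the last one, and the induction continues from [Q]. *)
Lemma regular_seq_chain (a : nat -> A) n (P : prime_idealr A)
    (f := fun j => scale_lin A^o (a j)) :
  endo_regular f n -> (forall x, endo_sum f n x -> x \in P) ->
  exists p : nat -> prime_idealr A,
    [/\ p n = P, forall i, (i < n)%N -> {subset p i <= p i.+1}
      & forall i, (i < n)%N -> exists2 a, a \in p i.+1 & a \notin p i].
Proof.
elim: n P => [|n IH] P reg hP; first by exists (fun=> P); split.
have fI i : idl (endo_sum f i) := endo_sum_subspace f i.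
have nP x : endo_sum f n x -> x \in P.
  by move=> hx; apply/hP/endo_sumS; exists x, 0; rewrite linear0 addr0.
(* This set contains the complement of [P], which puts [Q] inside [P], and [a n], which makes [Q]
   smaller. It misses the ideal since regularity cancels the powers of [a n]. *)
have [||||Q [fQ SQ]] := @krull A noeth (endo_sum f n)
   (fun x => exists s k, s \notin P /\ x = s * a n ^+ k).
- exact: fI.
- by exists 1, 0%N; rewrite expr0 mulr1 idealr1.
- move=> _ _ [s [k [hs ->]]] [s' [k' [hs' ->]]].
  exists (s * s'), (k + k')%N; split; last by rewrite exprD; ring.
  by rewrite prime_idealrM negb_or hs.
- move=> x0 hx [s [k [hs E]]]; case/negP: hs; apply: nP.
  move: hx; rewrite {}E; elim: k => [|k IHk]; first by rewrite expr0 mulr1.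
  rewrite exprS mulrCA => hx; apply: IHk.
  exact: (reg n (ltnSn n)) hx.
have QP : {subset Q <= P}.
  move=> x; apply: contraLR => hx; apply: SQ; exists x, 0%N; split=> //.
  by rewrite expr0 mulr1.
have [|p [pn pS pN]] := IH Q _ fQ.
  by move=> i lin; apply: reg; apply: ltnW.
exists (fun i => if (i <= n)%N then p i else P); split=> [|i|i].
- by rewrite ltnn.
- rewrite ltnS => lin; rewrite lin; case: ltnP => [|nle]; first exact: pS.
  by have -> : i = n by [apply/eqP; rewrite eqn_leq lin]; rewrite pn.
rewrite ltnS => lin; rewrite lin; case: ltnP => [|nle]; first exact: pN.
have -> : i = n by apply/eqP; rewrite eqn_leq lin.
rewrite pn; exists (a n).
  apply/hP/endo_sumS; exists 0, 1; split; first by case: (fI n).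
  by rewrite add0r /= [RHS]mulr1.
by apply: SQ; exists 1, 1%N; rewrite idealr1 mul1r expr1.
Qed.

Lemma regular_seq_le_dim (m : idealr A) d (a : nat -> A) n :
  ring_dim A = Some d -> (forall i, (i < n)%N -> a i \in m) ->
  endo_regular (fun j => scale_lin A^o (a j)) n -> (n <= d)%N.
Proof.
move=> /enat_sup_some[ub _] am reg; apply: ub.
set f := fun j => _ in reg.
have fI : idl (endo_sum f n) := endo_sum_subspace f n.
have fm x : endo_sum f n x -> x \in m.
  move=> [y ->]; apply: rpred_sum => i _.
  by rewrite /= [_ *: _]mulrC; apply/idealMr/am.
have [|||P [fP _]] := krull noeth (S := fun x => x = 1) fI.
- by [].
- by move=> x y -> ->; rewrite mulr1.
- by move=> x /fm + E; rewrite E idealr1.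
have [p [_ pS pN]] := regular_seq_chain reg fP.
by exists p; split=> // i _ x /eqP ->; exact: idealr0.
Qed.

Variables (m : idealr A).
Hypothesis mloc : forall m' : idealr A, maximal_ideal m' -> m' =i m.

Lemma local_unit u : u \notin m -> exists v, u * v = 1.
Proof.
move=> um; apply: contrapT => no.
have [||J [JI J1 Ju] Jmax] := idl_max noeth (Q := fun J => [/\ idl J, ~ J 1 & J u]).
- by move=> J [].
- exists (fun x => exists v, x = u * v); split.
  + split=> [|a _ _ [v ->] [w ->]]; first by exists 0; rewrite mulr0.
    by exists (a * v + w); ring.
  + by move=> [v E]; apply: no; exists v.
  + by exists 1; rewrite mulr1.
have [P hP] := idl_idealr JI J1.
have /mloc Pm : maximal_ideal P.
  move=> K PK x xK; apply/hP; apply: (Jmax (fun x => x \in K)) => //.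
    split; [exact: idealr_idl | by rewrite idealr1 | by apply/PK/hP].
  by move=> a /hP; exact: PK.
by move/negP: um; apply; rewrite -Pm; apply/hP.
Qed.

Section Socle.
Variable J : A -> Prop.
Hypothesis JI : idl J.

(** The ideal (J : b), annihilator of the class of [b] in A/J. *)
Let colon b x := J (x * b).
(** For such [b] the ideal (J : b) is an associated prime of A/J. *)
Let max_colon b := ~ J b /\ forall c, ~ J c -> (forall x, colon b x -> colon c x) ->
  forall x, colon c x -> colon b x.

Let colon_idl b : idl (colon b).
Proof.
split=> [|a x y hx hy]; rewrite /colon; first by rewrite mul0r; case: JI.
have -> : (a * x + y) * b = a * (x * b) + y * b by ring.
exact: JI.2.
Qed.

(** If [x] is not in (J : b), then [x * b] is not in J and (J : xb) contains (J : b), so both agree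
    by maximality. *)
Let max_colon_prime b x y : max_colon b -> colon b (x * y) -> ~ colon b x -> colon b y.
Proof.
move=> [Jb hb] hxy hx; apply: (hb (x * b)) => // [z hz|].
  by rewrite /colon mulrCA; apply: idlM.
by rewrite /colon mulrA [y * x]mulrC.
Qed.

Let max_colon_above c : ~ J c -> exists2 b, max_colon b & forall x, colon c x -> colon b x.
Proof.
move=> Jc.
have [||K [b [Jb [hK cb]]] Kmax] := idl_max noeth (Q := fun K =>
  exists b, ~ J b /\ (forall x, K x <-> colon b x) /\ (forall x, colon c x -> colon b x)).
- move=> K [b [_ [hK _]]]; split=> [|a x y /hK hx /hK hy]; apply/hK.
    by case: (colon_idl b).
  exact: (colon_idl b).2.
- by exists (colon c), c.
exists b => //; split=> // e Je be x ex; apply/hK.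
apply: (Kmax (colon e)) => // [|y /hK/be //]; exists e; split=> //; split=> // y /cb.
exact: be.
Qed.

(** Each [b'] contributes a factor in (J : b') outside (J : b); as (J : b) is prime, the product of
    these factors and [x0] stays outside. *)
Let avoid (S : seq A) (b x0 : A) : max_colon b -> x0 \in m -> ~ colon b x0 ->
  (forall b', b' \in S -> ~ (forall x, colon b' x -> colon b x)) ->
  exists z, [/\ z \in m, forall b', b' \in S -> colon b' z & ~ colon b z].
Proof.
move=> sb x0m bx0; elim: S => [|c S IH] hS; first by exists x0.
have [|z [zm zS zb]] := IH; first by move=> b' hb'; apply: hS; rewrite inE hb' orbT.
have /existsNP[y /not_implyP[cy by']] := hS c (mem_head _ _).
exists (y * z); split; first exact: idealMr.
  move=> b'; rewrite inE => /orP[/eqP->|/zS hz]; last exact: (idlM _ (colon_idl b')).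
  by rewrite mulrC; apply: (idlM _ (colon_idl c)).
by move=> h; apply: zb; apply: max_colon_prime h by'.
Qed.

(* Prime avoidance for the maximal annihilators of elements of A / J; these are
   finite in number because A is noetherian. *)
Lemma socle_or_regular :
  (forall b, ~ J b -> exists2 x, x \in m & ~ J (x * b)) ->
  exists2 x, x \in m & forall b, J (x * b) -> J b.
Proof.
move=> nosoc.
(* [E] consists of the elements sent into J by a finite intersection of maximal colon ideals. It
   contains every [b] with [max_colon b] and is finitely generated, so one finite [S] serves for all
   of them. *)
pose E e := exists S : seq A, (forall b, b \in S -> max_colon b) /\
   forall z, (forall b, b \in S -> colon b z) -> J (z * e).
have EI : idl E.
  split=> [|a x y [S [hS Sx]] [S' [hS' Sy]]].
    by exists [::]; split=> // z _; rewrite mulr0; case: JI.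
  exists (S ++ S'); split=> [b|z hz].
    by rewrite mem_cat => /orP[/hS|/hS'].
  have -> : z * (a * x + y) = a * (z * x) + z * y by ring.
  apply: JI.2; [apply: Sx|apply: Sy] => b hb; apply: hz; rewrite mem_cat hb ?orbT //.
have [s [sE sg]] := idl_fg noeth EI.
have [S [hS Ss]] : exists S : seq A, (forall b, b \in S -> max_colon b) /\
   forall e, e \in s -> forall z, (forall b, b \in S -> colon b z) -> J (z * e).
  elim: s sE {sg} => [|e s IH] sE; first by exists [::].
  have [S [hS hs]] := IH (fun x hx => sE x (mem_behead (s := e :: s) hx)).
  have [S' [hS' he]] := sE e (mem_head _ _).
  exists (S ++ S'); split=> [b|x]; first by rewrite mem_cat => /orP[/hS|/hS'].
  rewrite inE => /orP[/eqP-> z hz|hx z hz].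
    by apply: he => b hb; apply: hz; rewrite mem_cat hb orbT.
  by apply: hs => // b hb; apply: hz; rewrite mem_cat hb.
have SE b : max_colon b -> forall z, (forall b, b \in S -> colon b z) -> J (z * b).
  move=> sb z hz; have [|c ->] := sg b.
    by exists [:: b]; split=> [b'|y]; [rewrite inE => /eqP-> | apply; rewrite mem_head].
  rewrite mulr_sumr; apply: idl_sum => // i _; rewrite mulrCA; apply: idlM => //.
  by apply: Ss => //; apply: mem_nth.
(* Prime avoidance by induction on [S]: an [x] that falls into (J : b) is corrected by a [z] lying
   in all the earlier colon ideals but not in (J : b). *)
have [x xm hx] : exists2 x, x \in m & forall b, b \in S -> ~ colon b x.
  elim: S hS {Ss SE} => [|b S IH] hS; first by exists 0; rewrite ?idealr0.
  have [|x xm hx] := IH; first by move=> b' hb'; apply: hS; rewrite inE hb' orbT.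
  have [bx|bx] := EM (colon b x); last first.
    by exists x => // b'; rewrite inE => /orP[/eqP->|/hx].
  have sb := hS b (mem_head _ _).
  have [x0 x0m bx0] := nosoc b sb.1.
  have [|z [zm zS zb]] := @avoid S b x0 sb x0m bx0.
    move=> b' b'S sub; apply: (hx b' b'S).
    have [_ sb'] := hS b' (mem_behead (s := b :: S) b'S).
    exact: (sb' b sb.1 sub).
  exists (x + z); first by rewrite rpredD.
  move=> b'; rewrite inE => /orP[/eqP->|b'S] h.
    apply: zb; have -> : z = -1 * x + (x + z) by ring.
    exact: (colon_idl b).2.
  apply: (hx b' b'S); have -> : x = -1 * z + (x + z) by ring.
  by apply: (colon_idl b').2 => //; exact: zS.
(* If [x] killed the class of [c], it would lie in some maximal (J : b) different from those of [S];
   [avoid] then contradicts [SE]. *)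
exists x => // c xc; apply: contrapT => Jc.
have [b sb cb] := max_colon_above Jc.
have [x0 x0m bx0] := nosoc b sb.1.
have [|z [zm zS]] := @avoid S b x0 sb x0m bx0; last by apply; exact: SE.
move=> b' b'S sub; apply: (hx b' b'S).
by have [_ sb'] := hS b' b'S; apply: (sb' b sb.1 sub); apply: cb.
Qed.

End Socle.
End DepthDim.

(** * Vanishing beyond the dimension *)

Section FinGen.
Variable A : comNzRingType.
Implicit Types X Y Z : lmodType A.

Lemma fg_image Y Z (p : {linear Y -> Z}) :
  (forall z, exists y, p y = z) -> fin_generated Y -> fin_generated Z.
Proof.
move=> ps [s hs]; exists [seq p x | x <- s] => z; have [y <-] := ps z.
have /asboolP[c ->] := hs y; apply/asboolP; exists c.
rewrite size_map linear_sum; apply: eq_bigr => i _.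
by rewrite linearZ (nth_map 0).
Qed.

Definition generated_by Y (y : Y) := forall u, exists a : A, u = a *: y.

Lemma cyclic_fg Y (y : Y) : generated_by y -> fin_generated Y.
Proof.
move=> gy; exists [:: y] => u; have [a ->] := gy u.
by apply/asboolP; exists (fun=> a); rewrite big_ord1.
Qed.

Lemma cyclic_ses Y (z : Y) : exists (Z Q : lmodType A) (i : {linear Z -> Y})
   (p : {linear Y -> Q}) (z' : Z),
  [/\ ses i p, generated_by z', i z' = z & forall y, p y = 0 <-> exists a, y = a *: z].
Proof.
have sS : subspace (fun y : Y => exists a, y = a *: z).
  split=> [|a _ _ [b ->] [c ->]]; first by exists 0; rewrite scale0r.
  by exists (a * b + c); rewrite scalerDl scalerA.
have [Z [i [iI iE]]] := ex_submodule sS; have [Q [p s]] := ex_coker iI.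
have [z' hz'] : exists z', i z' = z by apply/iE; exists 1; rewrite scale1r.
exists Z, Q, i, p, z'; split=> // [u|y].
  have [a ha] : exists a, i u = a *: z by apply/iE; exists u.
  by exists a; apply: iI; rewrite linearZ hz'.
by case: s => _ e _; rewrite (e y) iE.
Qed.

Lemma regular_module_projective : projective A^o.
Proof.
move=> U V p f ps; have [u hu] := ps (f 1).
have gL : linear (fun a : A^o => (a : A) *: u).
  by move=> a x y; rewrite scalerDl -scalerA.
exists (mklin gL) => x; rewrite /= linearZ hu -linearZ; congr (f _).
exact: mulr1.
Qed.

End FinGen.

Section Vanishing.
Variables (A : comNzRingType) (m : idealr A) (d : nat).
Hypothesis mloc : noetherian_local m.
Hypothesis dimA : ring_dim A = Some d.

Let noeth : noetherian A. Proof. by case: mloc. Qed.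
Let mloc' : forall m' : idealr A, maximal_ideal m' -> m' =i m. Proof. by case: mloc. Qed.
Let unit_out := local_unit noeth mloc'.

Lemma endo_regular_extend (a : nat -> A) l x (f := fun j => scale_lin A^o (a j)) :
  endo_regular f l -> (forall b, endo_sum f l (x * b) -> endo_sum f l b) ->
  endo_regular (fun j => scale_lin A^o (if j == l then x else a j)) l.+1.
Proof.
move=> reg xreg i; set f' := fun j => _.
have E k y : (k <= l)%N -> endo_sum f' k y <-> endo_sum f k y.
  move=> kl; split=> -[z ->]; exists z; apply: eq_bigr => j _;
  by rewrite /f' ltn_eqF // (leq_trans (ltn_ord j)).
rewrite ltnS => il y /(E _ _ il) hy; apply/E => //.
move: il hy; rewrite /f' leq_eqVlt; case: eqP => [-> _|_ il] hy; first exact: xreg.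
exact: reg.
Qed.

(* A maximal A-regular sequence a in m leaves a socle element b in A/(a). *)
Lemma ex_maximal_regular_seq : exists (a : nat -> A) l,
  let f := fun j => scale_lin A^o (a j) in
  [/\ (l <= d)%N, endo_regular f l
    & exists2 b, ~ endo_sum f l b & forall x, x \in m -> endo_sum f l (x * b)].
Proof.
set goal := exists a, _.
pose reg_in (a : nat -> A) l := (forall i, (i < l)%N -> a i \in m) /\
  endo_regular (fun j => scale_lin A^o (a j)) l.
have bound a l : reg_in a l -> (l <= d)%N.
  by case=> am reg; exact: regular_seq_le_dim dimA am reg.
have step a l : reg_in a l -> goal \/ exists a', reg_in a' l.+1.
  move=> /[dup] areg [am reg]; set f := fun j => _ in reg.
  have fI : idl (endo_sum f l) := endo_sum_subspace f l.
  have [nosoc|] := EM (forall b, ~ endo_sum f l b ->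
     exists2 x, x \in m & ~ endo_sum f l (x * b)).
    have [x xm xreg] := socle_or_regular noeth fI nosoc; right.
    exists (fun i => if i == l then x else a i); split; last exact: endo_regular_extend.
    by move=> i; rewrite ltnS leq_eqVlt; case: eqP => // _ /am.
  move=> /existsNP[b /not_implyP[bJ bm]]; left; exists a, l; split=> //.
    exact: bound areg.
  by exists b => // x xm; apply: contrapT => h; apply: bm; exists x.
(* [k] bounds how often the sequence can still be lengthened before its length would exceed d. *)
suff H k a l : (d <= l + k)%N -> reg_in a l -> goal by apply: (H d (fun=> 0) 0%N).
elim: k a l => [|k IH] a l dl /step[//|[a' areg']].
  by have := bound _ _ areg'; rewrite ltnNge -[l]addn0 dl.
by apply: IH areg'; rewrite addSnnS.
Qed.

Section FixedModule.
Variable X : lmodType A.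
Hypothesis Xtors : forall x, x \in m -> forall z : X, tors_elt x z.

Implicit Types Y Z Q : lmodType A.

(** Starting from the flat module [A^o], each regular element raises the flat dimension by at most
    one. *)
Lemma tor_tors_regular_quotient (a : nat -> A) k n Q (p : {linear A^o -> Q})
    (f := fun j => scale_lin A^o (a j)) :
  endo_regular f k -> (k <= n)%N ->
  (forall q, exists x, p x = q) -> (forall x, p x = 0 <-> endo_sum f k x) ->
  tor_tors 1 n Q X.
Proof.
elim: k n Q p => [|k IH] n Q p reg kn ps pk.
  have pI : injective p by apply: lin_inj => x /pk[y ->]; rewrite big_ord0.
  have [g hg] := lin_lift_inj (f := id_lin Q) pI ps.
  apply: tor_tors_flatl; apply: (@flat_retract _ _ _ g p) => //.
  exact: projective_flat (@regular_module_projective A).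
case: n kn => // n kn.
have [Q' [p' [ps' pk']]] := ex_quotient (endo_sum_subspace f k).
have reg' : endo_regular f k by move=> i ik; apply: reg; apply: ltnW.
have [h s] := scalar_regular_ses reg (ltnSn k) ps' pk' ps pk.
by apply: (tor_tors_right s); apply: (IH _ _ p') => //; apply: leqW.
Qed.

Lemma ex_socle : exists (B : lmodType A) (b : B),
  [/\ fin_generated B, forall n, (d <= n)%N -> tor_tors 1 n B X
    & forall a, a *: b = 0 <-> a \in m].
Proof.
have [a [l [ld reg [b bJ bm]]]] := ex_maximal_regular_seq.
set f := fun j => _ in reg bJ bm.
have fI : idl (endo_sum f l) := endo_sum_subspace f l.
have [B [p [ps pk]]] := ex_quotient (endo_sum_subspace f l).
exists B, (p b); split=> [|n dn|y].
- apply: (fg_image ps); apply: (@cyclic_fg A A^o 1) => u; exists u.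
  by rewrite [RHS]mulr1.
- by apply: (tor_tors_regular_quotient reg) ps pk; apply: leq_trans dn.
rewrite -linearZ pk; split=> [h|]; last exact: bm.
(* A unit killing the class of [b] would put [b] itself into the ideal of the sequence. *)
apply: contraT => /unit_out[v hv]; case: bJ.
by have := idlM v fI h; rewrite /= -[_ *: _]/(y * b) mulrA [v * y]mulrC hv mul1r.
Qed.

Lemma tor_tors_step n : (d <= n)%N ->
  (forall Y, fin_generated Y -> tor_tors 1 n.+1 Y X) ->
  forall Y, fin_generated Y -> tor_tors 1 n Y X.
Proof.
move=> dn IH.
(* Vanishing for A/J, stated for all cyclic modules with annihilator J so that no model of A/J has
   to be fixed. *)
pose good (J : A -> Prop) := forall Y (y : Y), generated_by y ->
    (forall a, a *: y = 0 <-> J a) -> tor_tors 1 n Y X.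
have cyc J0 : idl J0 -> good J0.
  move=> J0I; apply: contrapT => J0bad.
  (* Noetherian induction: for a maximal bad [J], the cyclic modules with strictly larger
     annihilator are settled. *)
  have [||J [JI Jbad] Jmax] := idl_max noeth (Q := fun J => idl J /\ ~ good J).
  - by move=> K [].
  - by exists J0.
  apply: Jbad => Y y gy ann_y.
  have [J1|J1] := EM (J 1).
    apply: tor_tors_zero => u; have [a ->] := gy u; apply/ann_y.
    by rewrite -[a]mulr1; apply: idlM.
  have larger Z (z : Z) : generated_by z -> (forall a, J a -> a *: z = 0) ->
      (exists2 a, ~ J a & a *: z = 0) -> tor_tors 1 n Z X.
    move=> gz Jz [a Ja az]; apply: contrapT => nT; apply: Ja.
    apply: (Jmax (fun b => b *: z = 0)) => //; split.
      split=> [|b u v hu hv]; first by rewrite scale0r.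
      by rewrite scalerDl -scalerA hu hv scaler0 addr0.
    by move=> G; apply: nT; apply: (G Z z).
  (* If J is not prime, split [Y] into its submodule generated by [a *: y], killed by [b], and the
     quotient, killed by [a]; both annihilators exceed J. *)
  have [[b [a [Jba Jb Ja]]]|noprime] := EM (exists b a, [/\ J (b * a), ~ J b & ~ J a]).
    have [Z [Q [i [p [z' [s gz' iz' pk]]]]]] := cyclic_ses (a *: y).
    have [iI _ ps] := s.
    apply: (tor_tors_mid s).
      apply: (larger _ z') => // [c Jc|].
        apply: iI; rewrite linearZ iz' linear0 /= scalerA mulrC -scalerA.
        by have -> : c *: y = 0 by [apply/ann_y]; rewrite scaler0.
      by exists b => //; apply: iI; rewrite linearZ iz' linear0 /= scalerA; apply/ann_y.
    apply: (larger _ (p y)) => [q|c Jc|].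
    - by have [u <-] := ps q; have [c ->] := gy u; exists c; rewrite linearZ.
    - by rewrite -linearZ; have -> : c *: y = 0 by [apply/ann_y]; rewrite linear0.
    by exists a => //; rewrite -linearZ; apply/pk; exists 1; rewrite scale1r.
  have [[x xm Jx]|mJ] := EM (exists2 x, x \in m & ~ J x).
    have xI : injective (scale_lin Y x).
      apply: lin_inj => u /=; have [c ->] := gy u; rewrite scalerA => /ann_y Jxc.
      by apply/ann_y; apply: contrapT => Jc; apply: noprime; exists x, c.
    have [Q [p s]] := ex_coker xI.
    apply: (tor_tors_regular_tors (Xtors xm) s); apply: IH.
    by case: s => _ _ ps; apply: (fg_image ps); apply: cyclic_fg gy.
  have Jm a : J a <-> a \in m.
    split=> [Ja|am]; last by apply: contrapT => Ja; apply: mJ; exists a.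
    by apply: contraT => /unit_out[v hv]; case: J1; rewrite -hv mulrC; apply: idlM.
  have [B [b [fgB TB ann_b]]] := ex_socle.
  have mulL Z (z : Z) : linear (fun a : A^o => (a : A) *: z).
    by move=> c u v; rewrite scalerDl -scalerA.
  have [||i hi] := @lin_lift_surj _ _ _ _ (mklin (mulL Y y)) (mklin (mulL B b)).
  - by move=> u; have [a ->] := gy u; exists a.
  - by move=> a /= /ann_y/Jm/ann_b.
  have iI : injective i.
    apply: lin_inj => u; have [a ->] := gy u; rewrite -[a *: y]/(mklin (mulL Y y) a) hi.
    by move=> /= /ann_b/Jm/ann_y.
  have [Q [p s]] := ex_coker iI.
  apply: (tor_tors_left s); first exact: TB.
  by apply: IH; case: s => _ _ ps; apply: fg_image fgB.
(* Induction on the number of generators reduces to cyclic modules. *)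
move=> Y [s]; move: {2}(size s) (erefl (size s)) => k.
elim: k Y s => [|k IHk] Y [|y s] //= ks hs.
  apply: tor_tors_zero => u; have /asboolP[c ->] := hs u; exact: big_ord0.
have [Z [Q [i [p [z' [ss gz' iz' pk]]]]]] := cyclic_ses y.
apply: (tor_tors_mid ss).
  apply: (cyc (fun a => a *: z' = 0)) gz' _ => //; split=> [|b u v hu hv].
    by rewrite scale0r.
  by rewrite scalerDl -scalerA hu hv scaler0 addr0.
case: ks => ks; apply: (IHk _ [seq p u | u <- s]); first by rewrite size_map.
case: ss => _ _ ps q; have [u <-] := ps q; have /asboolP[c ->] := hs u.
apply/asboolP; exists (fun i => c i.+1).
rewrite /= big_ord_recl linearD linearZ /= (proj2 (pk y)) ?scaler0 ?add0r; last first.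
  by exists 1; rewrite scale1r.
rewrite size_map linear_sum; apply: eq_bigr => j _.
by rewrite linearZ /= (nth_map 0).
Qed.

Hypothesis Xfd : exists n0, forall Y n, fin_generated Y -> (n0 <= n)%N -> tor_tors 1 n Y X.

(** Descending induction from the bound in [Xfd], one [tor_tors_step] per degree. The resulting
    bound d no longer depends on [X]. *)
Lemma tor_tors_fg_vanish n Y : (d <= n)%N -> fin_generated Y -> tor_tors 1 n Y X.
Proof.
have [n0 h0] := Xfd.
have : (n0 <= n + n0)%N by rewrite leq_addl.
move: {2}n0 => k; elim: k n Y => [|k IH] n Y; first by rewrite addn0 => nk _ fY; apply: h0.
move=> nk dn fY; apply: tor_tors_step => // Z fZ.
by apply: IH => //; rewrite ?addSnnS // leqW.
Qed.

(* Along an M-regular sequence of length d, tor_tors_regular_tors lowers the degree of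
   vanishing from d to 0. *)
Lemma tor_tors_regular_module (a : nat -> A) Y n (f := fun j => scale_lin Y (a j)) :
  fin_generated Y -> (forall i, (i < d)%N -> a i \in m) -> endo_regular f d ->
  tor_tors 1 n Y X.
Proof.
move=> fY am reg.
(* For Q = Y/(a_0, ..., a_(i-1)) the vanishing starts at index i. The case i = d is
   [tor_tors_fg_vanish], and k = d - i counts the elements removed since. *)
suff H k : (k <= d)%N -> forall i, (i + k)%N = d -> forall Q (p : {linear Y -> Q}),
    (forall q, exists y, p y = q) -> (forall y, p y = 0 <-> endo_sum f i y) ->
    forall n, (i <= n)%N -> tor_tors 1 n Q X.
  have [||g hg] := @lin_lift_inj _ _ _ _ (id_lin Y) (id_lin Y) => //.
    by move=> w; exists w.
  apply: (H d (leqnn d) 0%N _ Y (id_lin Y)) => // [q|y]; first by exists q.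
  split=> [/= ->|[z ->]]; last by rewrite big_ord0.
  by exists (fun=> 0); rewrite big_ord0.
elim: k => [|k IH] kd i id Q p ps pk l il.
  apply: tor_tors_fg_vanish; first by rewrite -id addn0.
  exact: fg_image ps fY.
have lid : (i < d)%N by rewrite -id addnS ltnS leq_addr.
have [Q' [p' [ps' pk']]] := ex_quotient (endo_sum_subspace f i.+1).
have [h s] := scalar_regular_ses reg lid ps pk ps' pk'.
apply: (tor_tors_regular_tors (Xtors (am i lid)) s).
by apply: (IH (ltnW kd) i.+1 _ Q' p') => //; rewrite addSnnS.
Qed.

End FixedModule.
End Vanishing.

(** * Tensoring regular sequences *)

Section RegularTensor.
Variables (A : comNzRingType) (m : idealr A) (M : lmodType A).

(* The modules X that are m-torsion and of finite flat dimension, as tested on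
   finitely generated modules. *)
Definition tors_fd (X : lmodType A) :=
  (forall x, x \in m -> forall z : X, tors_elt x z) /\
  exists n0, forall Y n, fin_generated Y -> (n0 <= n)%N -> tor_tors 1 n Y X.

Hypothesis MT : forall X, tors_fd X -> forall n, tor_tors 1 n M X.

Variables (H : lmodType A) (f : nat -> {linear H -> H}).
Hypothesis fC : forall i j x, f i (f j x) = f j (f i x).
Hypothesis HC : tors_fd H.

Lemma tors_fd_surj_tors (X Q : lmodType A) (p : {linear X -> Q}) :
  (forall q, exists x, p x = q) -> (forall x, x \in m -> forall z : X, tors_elt x z) ->
  forall x, x \in m -> forall z : Q, tors_elt x z.
Proof. by move=> ps hX x xm q; have [y <-] := ps q; apply/tors_elt_map/hX. Qed.

(** Each division by some f_i costs one degree, hence the bound [n0 + k]. *)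
Lemma tors_fd_quot k (Q : lmodType A) (p : {linear H -> Q}) : endo_regular f k ->
  (forall q, exists x, p x = q) -> (forall x, p x = 0 <-> endo_sum f k x) ->
  tors_fd Q.
Proof.
have [Ht [n0 Hn]] := HC.
move=> reg ps pk; split; first exact: tors_fd_surj_tors ps Ht.
exists (n0 + k)%N; elim: k Q p reg ps pk => [|k IH] Q p reg ps pk Y n fY.
  rewrite addn0 => n0n.
  have pI : injective p by apply: lin_inj => x /pk[y ->]; rewrite big_ord0.
  have [W [q s]] := ex_coker pI.
  apply/tor_torsC/(tor_tors_mid s); apply/tor_torsC; first exact: Hn.
  apply/tor_torsC/tor_tors_zero => w; case: s => _ e qs; have [v <-] := qs w.
  by apply/e; exact: ps.
rewrite addnS; case: n => // n kn.
have [Q' [p' [ps' pk']]] := ex_quotient (endo_sum_subspace f k).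
have reg' : endo_regular f k by move=> i ik; apply: reg; apply: ltnW.
have [g [h [_ _ s]]] := endo_regular_ses fC reg (ltnSn k) ps' pk' ps pk.
by apply/tor_torsC/(tor_tors_right s); apply/tor_torsC; apply: (IH _ p') => //; apply: leqW.
Qed.

(* Tor_1(M, H/(f_0, ..., f_i)) = 0, so tensoring with M keeps f_i injective on
   H/(f_0, ..., f_(i-1)). *)
Lemma tensor_endo_regular k : endo_regular f k ->
  endo_regular (fun j => tmapr M (f j)) k.
Proof.
move=> reg i ik w hw.
have reg' j : (j <= k)%N -> endo_regular f j.
  by move=> jk l lj; apply: reg; apply: leq_trans jk.
have [Q [p [ps pk]]] := ex_quotient (endo_sum_subspace f i).
have [Q' [p' [ps' pk']]] := ex_quotient (endo_sum_subspace f i.+1).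
have [g [h [hg _ s]]] := endo_regular_ses fC reg ik ps pk ps' pk'.
have gI : ker_tors 1 (tmapr M g).
  exact: (MT (tors_fd_quot (reg' _ ik) ps' pk') 0) s.
have pw0 : tmapr M p w = 0.
  apply/tors_elt1/gI; rewrite (@tmapr_comp _ _ _ _ _ _ _ (comp_lin p (f i))) //.
  rewrite -(@tmapr_comp _ _ _ _ _ (f i) p) //.
  case: hw => y ->; rewrite linear_sum; apply: big1 => j _.
  rewrite (@tmapr_comp _ _ _ _ _ _ _ (comp_lin p (f j))) //.
  apply: tmapr0 => x /=; apply/pk.
  exists (fun l : nat => if l == j :> nat then x else 0).
  rewrite (bigD1 j) //= eqxx big1 ?addr0 // => l /negPf lj.
  by rewrite -[(l : nat) == _]/(l == j) lj linear0.
(* By right exactness [w] comes from M (x) ker p, and ker p is the sum of the images of f_0, ...,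
   f_(i-1); pure tensors suffice. *)
have [S [io sS]] := ex_ker ps.
have [_ e _] := sS; have [t <-] := tmapr_exact e ps pw0.
elim/tensor_ind: t => [u v hu hv|y u].
  by rewrite linearD; apply: subspaceD hu hv; apply: endo_sum_subspace.
have /pk[z hz] := ses0 u sS.
exists (fun j => tens y (z j)); rewrite tmapE /= hz.
have tL : linear (tens y : H -> tensor M H) by move=> a t t'; rewrite tensDr tensZr.
rewrite -[LHS]/(mklin tL _) linear_sum; apply: eq_bigr => j _.
by rewrite /= tmapE.
Qed.

End RegularTensor.

(** * Torsion of the modules N/I^j N *)

Section Torsion.
Variables (A : comNzRingType) (m I : idealr A).
Hypothesis mloc : noetherian_local m.

Let unit_out : forall u, u \notin m -> exists v, u * v = 1.
Proof. by case: mloc => n _ h; apply: local_unit. Qed.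

(** The submodules A x^k w descend, so x^k w = a x^(k+1) w for some k and a; then 1 - ax is a unit
    killing x^k w. *)
Lemma finite_length_tors (W : lmodType A) : finite_length W ->
  forall x, x \in m -> forall w : W, tors_elt x w.
Proof.
move=> fl x xm w.
have [k [a kw]] : exists k a, x ^+ k *: w = a *: (x ^+ k.+1 *: w).
  apply: contrapT => no.
  have [d hd] := enat_inf_none fl.
  suff : (d.+1 <= d)%N by rewrite ltnn.
  apply: hd.
  have S n : subspace (fun z : W => exists a, z = a *: (x ^+ n *: w)).
    split=> [|a _ _ [b ->] [c ->]]; first by exists 0; rewrite scale0r.
    by exists (a * b + c); rewrite [RHS]scalerDl -[in RHS]scalerA.
  exists (fun i => sub_of (S (d.+1 - i)%N)); split=> i id.
    move=> z /asboolP[a ->]; apply/asboolP; exists (a * x).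
    by rewrite subSn // exprS -!scalerA.
  exists (x ^+ (d.+1 - i.+1) *: w).
    by apply/asboolP; exists 1; rewrite scale1r.
  apply/asboolPn => -[a E]; apply: no; exists (d.+1 - i.+1)%N, a.
  by rewrite {}E subSS -subSn.
have : (1 - a * x) \notin m.
  apply/negP => h; have : 1 \in m.
    by rewrite -(subrK (a * x) 1) rpredD // idealMr.
  by rewrite idealr1.
move=> /unit_out[v hv]; exists k.
rewrite -[_ *: _]scale1r -hv mulrC -scalerA scalerBl scale1r.
have -> : (a * x) *: (x ^+ k *: w) = a *: (x ^+ k.+1 *: w).
  by rewrite exprS -!scalerA.
by rewrite -kw subrr scaler0.
Qed.

Variable N : lmodType A.
Hypothesis hI : ideal_of_definition m I N.

Lemma smul_mem (X : lmodType A) (J : {pred A}) (U : {pred X}) a x :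
  a \in J -> x \in U -> a *: x \in smul J U.
Proof.
move=> aJ xU; apply/asboolP; exists [:: (a, x)]; first by rewrite /= aJ xU.
by rewrite big_seq1.
Qed.

(** Some power of [x], depending on the element, moves it from I^l N into I^(l+1) N: for l = 0 since
    N/IN has finite length, and then by induction. *)
Lemma quot_pow_tors j x : x \in m ->
  forall z : quotmod (pow_mul I N j), tors_elt x z.
Proof.
move=> xm.
have tN : forall y, exists k, x ^+ k *: y \in pow_mul I N 1.
  move=> y; have [k hk] := finite_length_tors hI.2 xm (qpi (pow_mul I N 1) y).
  by exists k; apply/qpi_eq0; rewrite linearZ.
have step l : forall y, y \in pow_mul I N l -> exists k, x ^+ k *: y \in pow_mul I N l.+1.
  elim: l => [|l IH] y; first by move=> _; exact: tN.
  move=> /asboolP[s hs ->].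
  elim: s hs => [|p s IHs] /=; first exists 0%N.
    by rewrite big_nil scaler0; exact: (rpred0 (pow_mul I N l.+2)).
  move=> /andP[/andP[p1 p2] /IHs[k hk]]; have [k' hk'] := IH _ p2.
  exists (k + k')%N; rewrite big_cons scalerDr; apply: (@rpredD _ (pow_mul I N l.+2)).
    rewrite scalerA mulrC -scalerA; apply: smul_mem => //.
    by rewrite exprD -scalerA; apply: (@rpredZ _ _ (pow_mul I N l.+1)).
  by rewrite addnC exprD -scalerA; apply: (@rpredZ _ _ (pow_mul I N l.+2)).
have tj y : exists k, x ^+ k *: y \in pow_mul I N j.
  elim: j => [|l [k hk]]; first by exists 0%N.
  by have [k' hk'] := step _ _ hk; exists (k' + k)%N; rewrite exprD -scalerA.
move=> z; have [y <-] := qpi_surj z; have [k hk] := tj y.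
by exists k; rewrite -linearZ; apply/qpi_eq0.
Qed.

End Torsion.

Section Layers.
Variables (A : comNzRingType) (I : idealr A) (X : lmodType A).

Lemma pow_mulS n (x : X) : x \in pow_mul I X n.+1 -> x \in pow_mul I X n.
Proof.
elim: n x => [|n IH] x //; move=> /asboolP[s hs ->]; apply/asboolP; exists s => //.
by apply: sub_all hs => p /andP[-> /IH].
Qed.

(* S is I^j X / I^(j+1) X inside X / I^(j+1) X. *)
Lemma ex_layer j : exists (S : lmodType A) (io : {linear S -> quotmod (pow_mul I X j.+1)})
    (p : {linear quotmod (pow_mul I X j.+1) -> quotmod (pow_mul I X j)}),
  ses io p /\ forall x, p (qpi _ x) = qpi _ x.
Proof.
have [|p hp] := lin_lift_surj (f := qpi (pow_mul I X j)) (@qpi_surj _ _ (pow_mul I X j.+1)).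
  by move=> u /qpi_eq0/pow_mulS hu; apply/qpi_eq0.
have ps : forall q, exists x, p x = q.
  by move=> q; have [x <-] := qpi_surj q; exists (qpi _ x).
by have [S [io s]] := ex_ker ps; exists S, io, p.
Qed.

End Layers.

(** * Associated graded modules over the base ring *)

Section GradedOverBase.
Local Open Scope quotient_scope.
Variables (A : comNzRingType) (I : idealr A).

Fact const_reesP (a : A) : a%:P \in rees_pred I.
Proof.
apply/asboolP => n; rewrite coefC; case: n => [|n] //.
exact: (rpred0 (pow_mul I A^o n.+1)).
Qed.
Definition const_rees (a : A) : rees I := Sub a%:P (const_reesP a).
Definition const_gr (a : A) : gr_ring I := \pi_{ideal_quot (@rees_ideal A I)} (const_rees a).

Lemma const_gr1 : const_gr 1 = 1.
Proof.
rewrite -(rmorph1 (\pi_{ideal_quot (@rees_ideal A I)}));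
congr (\pi_{ideal_quot (@rees_ideal A I)} _).
by apply: val_inj; rewrite /= polyC1.
Qed.
Lemma const_grD a b : const_gr (a + b) = const_gr a + const_gr b.
Proof.
rewrite -(rmorphD (\pi_{ideal_quot (@rees_ideal A I)}));
congr (\pi_{ideal_quot (@rees_ideal A I)} _).
by apply: val_inj; rewrite /= polyCD.
Qed.
Lemma const_grM a b : const_gr (a * b) = const_gr a * const_gr b.
Proof.
rewrite -(rmorphM (\pi_{ideal_quot (@rees_ideal A I)}));
congr (\pi_{ideal_quot (@rees_ideal A I)} _).
by apply: val_inj; rewrite /= polyCM.
Qed.

Variable X : lmodType A.

(* G_I(X) with scalars restricted along A -> G_I(A) *)
Definition gr_base : Type := gr_mod I X.
HB.instance Definition _ := GRing.Zmodule.on gr_base.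

Definition gr_base_scale (a : A) (x : gr_base) : gr_base :=
  const_gr a *: (x : gr_mod I X).

Fact gr_base_scaleA a b x : gr_base_scale a (gr_base_scale b x) = gr_base_scale (a * b) x.
Proof. by rewrite /gr_base_scale const_grM -scalerA. Qed.
Fact gr_base_scale1 : left_id 1 gr_base_scale.
Proof. by move=> x; rewrite /gr_base_scale const_gr1 scale1r. Qed.
Fact gr_base_scaleDr : right_distributive gr_base_scale +%R.
Proof. by move=> a x y; rewrite /gr_base_scale; exact: scalerDr. Qed.
Fact gr_base_scaleDl x : {morph gr_base_scale^~ x : a b / a + b}.
Proof. by move=> a b; rewrite /gr_base_scale const_grD; exact: scalerDl. Qed.
HB.instance Definition _ := GRing.Zmodule_isLmodule.Build A gr_base
  gr_base_scaleA gr_base_scale1 gr_base_scaleDr gr_base_scaleDl.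

Fact gr_act_linear (g : gr_ring I) : linear (fun x : gr_base => g *: (x : gr_mod I X) : gr_base).
Proof.
move=> a x y; rewrite [LHS](scalerDr g (const_gr a *: (x : gr_mod I X))); congr (_ + _).
by rewrite scalerA [LHS]/= mulrC -scalerA.
Qed.
Definition gr_act g : {linear gr_base -> gr_base} := mklin (gr_act_linear g).

Lemma gr_actC g h x : gr_act g (gr_act h x) = gr_act h (gr_act g x).
Proof. by rewrite /= [LHS]scalerA [RHS]scalerA mulrC. Qed.

Definition gr_rep (x : gr_base) : rees_mod I X :=
  repr (x : Quotient.quot (zmod_pred (@rees_mod_next A I X))).

Lemma gr_repK x : gr_pi (gr_rep x) = x.
Proof. exact: quotmod_reprK. Qed.

Lemma gr_pi_act (f : rees I) (x : rees_mod I X) :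
  (\pi_{ideal_quot (@rees_ideal A I)} f : gr_ring I) *: (gr_pi x : gr_mod I X) = gr_pi (f *: x).
Proof. exact: gr_scale_pi. Qed.

Let layer j := quotmod (pow_mul I X j.+1).

(** The component is taken in X/I^(j+1) X rather than in I^j X/I^(j+1) X, which avoids a subtype;
    [gr_comp_layer] records where it lies. *)
Definition gr_comp_fun j (x : gr_base) : layer j := qpi _ (val (gr_rep x) j).

Lemma gr_comp_pi_fun j (f : rees_mod I X) : gr_comp_fun j (gr_pi f) = qpi _ (val f j).
Proof.
apply/qpi_eq; have /gr_piP := gr_repK (gr_pi f); exact.
Qed.

Lemma const_act a (f : rees_mod I X) n : val (const_rees a *: f) n = a *: val f n.
Proof.
rewrite [LHS]/(conv (val (const_rees a)) (val f) n) /conv big_ord_recl /= subn0 coefC eqxx.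
by rewrite big1 ?addr0 // => i _; rewrite coefC scale0r.
Qed.

Fact gr_comp_linear j : linear (@gr_comp_fun j).
Proof.
move=> a x y; have [f ->] := gr_pi_surj x; have [g ->] := gr_pi_surj y.
have -> : a *: (gr_pi f : gr_base) + gr_pi g = gr_pi (const_rees a *: f + g) :> gr_base.
  by rewrite gr_piD; congr (_ + _); exact: gr_pi_act.
rewrite !gr_comp_pi_fun -linearP; congr (qpi _ _).
by rewrite [LHS]/(val (const_rees a *: f) j + val g j) const_act.
Qed.
Definition gr_comp j : {linear gr_base -> layer j} := mklin (@gr_comp_linear j).

Lemma gr_comp_pi j (f : rees_mod I X) : gr_comp j (gr_pi f) = qpi _ (val f j).
Proof. exact: gr_comp_pi_fun. Qed.

Lemma gr_comp_inj (x y : gr_base) : (forall j, gr_comp j x = gr_comp j y) -> x = y.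
Proof.
have [f ->] := gr_pi_surj x; have [g ->] := gr_pi_surj y => h.
by apply/gr_piP => n; apply/qpi_eq; have := h n; rewrite !gr_comp_pi.
Qed.

Lemma gr_comp_bound (x : gr_base) : exists k, forall j, (k <= j)%N -> gr_comp j x = 0.
Proof.
have [f ->] := gr_pi_surj x; have /asboolP[[k hk] _] := valP f.
by exists k => j kj; rewrite gr_comp_pi hk // linear0.
Qed.

Lemma gr_comp_layer j (x : gr_base) : exists2 y, y \in pow_mul I X j & gr_comp j x = qpi _ y.
Proof.
have [f ->] := gr_pi_surj x; have /asboolP[_ hf] := valP f.
by exists (val f j); rewrite ?gr_comp_pi.
Qed.

Lemma ex_gr (f : nat -> X) : (forall j, f j \in pow_mul I X j) ->
  (exists k, forall j, (k <= j)%N -> f j = 0) ->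
  exists x : gr_base, forall j, gr_comp j x = qpi _ (f j).
Proof.
move=> hf bf; have fP : f \in @rees_mod_pred A I X by apply/asboolP.
by exists (gr_pi (Sub f fP : rees_mod I X)) => j; rewrite gr_comp_pi.
Qed.

Lemma ex_gr_hom j y : y \in pow_mul I X j ->
  exists x : gr_base, gr_comp j x = qpi _ y /\ forall k, k != j -> gr_comp k x = 0.
Proof.
move=> hy; have [k||x hx] := @ex_gr (fun k => if k == j then y else 0).
- by case: eqP => [->|_] //; exact: (rpred0 (pow_mul I X k)).
- by exists j.+1 => k; case: eqP => // ->; rewrite ltnn.
exists x; split=> [|k /negPf kj]; first by rewrite hx eqxx.
by rewrite hx kj linear0.
Qed.

Lemma gr_comp_sum (z : gr_base) (h : nat -> gr_base) l :
  (forall j, (l <= j)%N -> gr_comp j z = 0) ->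
  (forall j, gr_comp j (h j) = gr_comp j z) ->
  (forall j k, k != j -> gr_comp k (h j) = 0) -> z = \sum_(j < l) h j.
Proof.
move=> zl hj hk; apply: gr_comp_inj => k; rewrite linear_sum.
have [lk|kl] := leqP l k.
  rewrite zl // big1 // => j _; apply: hk.
  by rewrite neq_ltn (leq_trans (ltn_ord j) lk) orbT.
rewrite (bigD1 (Ordinal kl)) // big1 => [|j nj].
  by rewrite -(hj k); exact: (esym (addr0 _)).
by apply: (hk j k); rewrite eq_sym.
Qed.

Lemma gr_direct_sum : exists (S : nat -> lmodType A)
    (inc : forall j, {linear S j -> layer j})
    (p : forall j, {linear layer j -> quotmod (pow_mul I X j)})
    (io : forall j, {linear S j -> gr_base}) (pr : forall j, {linear gr_base -> S j}),
  [/\ forall j, ses (inc j) (p j),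
      forall z : gr_base, exists k, forall l, (k <= l)%N -> z = \sum_(j < l) io j (pr j z)
    & forall j z, inc j (pr j z) = gr_comp j z].
Proof.
(* The data of one degree are packed together, so that a single choice for each j keeps them
   compatible. *)
have H0 (j : nat) : exists E : {S : lmodType A & ({linear S -> layer j} *
    ({linear layer j -> quotmod (pow_mul I X j)} * ({linear S -> gr_base} *
     {linear gr_base -> S})))%type},
  let: existT S0 (inc, (p, (io, pr))) := E in
  [/\ ses inc p, forall s, gr_comp j (io s) = inc s,
      forall s k, k != j -> gr_comp k (io s) = 0
    & forall z, inc (pr z) = gr_comp j z].
  have [S [inc [p [s hp]]]] := ex_layer I X j; have [iI e ps] := s.
  have [|pr hpr] := lin_lift_inj (f := gr_comp j) iI.
    move=> x; apply/e; have [y hy ->] := gr_comp_layer j x.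
    by rewrite hp; apply/qpi_eq0.
  have Hg (t : S) : exists x : gr_base,
      gr_comp j x = inc t /\ forall k, k != j -> gr_comp k x = 0.
    have [y hy] := qpi_surj (inc t); rewrite -hy; apply: ex_gr_hom.
    by apply/qpi_eq0; rewrite -hp hy (ses0 t s).
  have [g hg] := choice Hg.
  have gL : linear g.
    move=> a x y; apply: gr_comp_inj => k; rewrite linearP.
    have [->|kj] := eqVneq k j; first by rewrite !(proj1 (hg _)) linearP.
    by rewrite !(proj2 (hg _)) // scaler0 addr0.
  exists (existT _ S (inc, (p, (mklin gL, pr)))); split=> // t; first by case: (hg t).
  by case: (hg t).
pose E j := projT1 (cid (H0 j)).
exists (fun j => tag (E j)), (fun j => (tagged (E j)).1), (fun j => (tagged (E j)).2.1),
  (fun j => (tagged (E j)).2.2.1), (fun j => (tagged (E j)).2.2.2).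
split=> [j|z|j z].
- by rewrite /E; case: (cid (H0 j)) => -[S [inc [p [io pr]]]] [].
- have [k hk] := gr_comp_bound z; exists k => l kl.
  apply: (@gr_comp_sum z (fun j => (tagged (E j)).2.2.1 ((tagged (E j)).2.2.2 z)))
    => [j lj|j|j i ij].
  + by apply: hk; apply: leq_trans lj.
  + by rewrite /E; case: (cid (H0 j)) => -[S [inc [p [io pr]]]] /= [_ -> _ ->].
  rewrite /E; case: (cid (H0 j)) => -[S [inc [p [io pr]]]] /= [_ _ hij _].
  exact: hij.
by rewrite /E; case: (cid (H0 j)) => -[S [inc [p [io pr]]]] /= [_ _ _ ->].
Qed.

End GradedOverBase.
Arguments gr_comp {A I X} j.

Section GradedAction.
Local Open Scope quotient_scope.
Variables (A : comNzRingType) (I : idealr A).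

Definition gr_coef (g : gr_ring I) i : A :=
  (val (repr (g : {ideal_quot (@rees_ideal A I)})))`_i.

Lemma gr_coefP g i : gr_coef g i \in ideal_pow I i.
Proof.
by rewrite /gr_coef; case: (repr _) => p /= /asboolP.
Qed.

(** Any lifts [y j] may be used: changing one by an element of I^(k-i+1) X and multiplying by a
    coefficient in I^i changes the sum within I^(k+1) X. *)
Lemma gr_act_comp (X : lmodType A) g (x : gr_base I X) (y : nat -> X) k :
  (forall j, gr_comp j x = qpi _ (y j)) ->
  gr_comp k (gr_act X g x) = qpi _ (\sum_(i < k.+1) gr_coef g i *: y (k - i)%N).
Proof.
have [r ->] := gr_pi_surj x => h.
have -> : gr_act X g (gr_pi r) =
    gr_pi (repr (g : {ideal_quot (@rees_ideal A I)}) *: r) :> gr_base I X.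
  by rewrite -gr_pi_act reprK.
rewrite gr_comp_pi; apply/qpi_eq.
rewrite [val (_ *: r) k]/(conv (val (repr (g : {ideal_quot (@rees_ideal A I)}))) (val r) k).
rewrite /conv -sumrB; apply: (@rpred_sum _ (pow_mul I X k.+1)) => i _.
rewrite -scalerBr; apply: (pow_mulM_eq _ (gr_coefP g i)) (_ : _ \in pow_mul I X (k - i).+1).
  by rewrite addnS subnKC // -ltnS.
by apply/qpi_eq; rewrite -h gr_comp_pi.
Qed.

Lemma seq_mul_act (X : lmodType A) (s : seq (gr_ring I)) i (x : gr_mod I X) :
  (i <= size s)%N -> (x \in seq_mul (gr_mod I X) (take i s)) <->
  endo_sum (fun j => gr_act X s`_j) i x.
Proof.
move=> si; split=> [/asboolP[y ->]|[y ->]]; last (apply/asboolP; exists y).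
  exists y; rewrite size_takel //; apply: eq_bigr => j _.
  by rewrite /= nth_take.
by rewrite size_takel //; apply: eq_bigr => j _; rewrite /= nth_take.
Qed.

End GradedAction.

Lemma seq_mul_scale (A : comNzRingType) (X : lmodType A) (s : seq A) i x :
  (i <= size s)%N -> (x \in seq_mul X (take i s)) <->
  endo_sum (fun j => scale_lin X s`_j) i x.
Proof.
move=> si; split=> [/asboolP[y ->]|[y ->]]; last (apply/asboolP; exists y).
  exists y; rewrite size_takel //; apply: eq_bigr => j _.
  by rewrite /= nth_take.
by rewrite size_takel //; apply: eq_bigr => j _; rewrite /= nth_take.
Qed.

(** * The comparison map M (x) G_I(N) -> G_I(M (x) N) *)

Section GradedTensor.
Variables (A : comNzRingType) (I : idealr A) (M N : lmodType A).

Lemma tens0 (x : M) : tens x (0 : N) = 0.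
Proof. by rewrite -(scale0r 0) tensZr scale0r. Qed.

Lemma tens_sum (x : M) (J : Type) (s : seq J) (P : pred J) (F : J -> N) :
  tens x (\sum_(j <- s | P j) F j) = \sum_(j <- s | P j) tens x (F j).
Proof.
have tL : linear (tens x : N -> tensor M N) by move=> a t t'; rewrite tensDr tensZr.
exact: (linear_sum (mklin tL)).
Qed.

Lemma tens_pow j (x : M) (y : N) :
  y \in pow_mul I N j -> tens x y \in pow_mul I (tensor M N) j.
Proof.
elim: j y => [|j IH] y //; move=> /asboolP[s hs ->]; apply/asboolP.
exists [seq (p.1, tens x p.2) | p <- s].
  by rewrite all_map; apply: sub_all hs => p /= /andP[-> /IH].
by rewrite big_map tens_sum; apply: eq_bigr => p _; rewrite tensZr.
Qed.

Lemma pow_tens j (u : tensor M N) : u \in pow_mul I (tensor M N) j ->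
  exists2 s : seq (M * N), all (fun p => p.2 \in pow_mul I N j) s &
    u = \sum_(p <- s) tens p.1 p.2.
Proof.
elim: j u => [|j IH] u.
  move=> _; elim/tensor_ind: u => [u v [s hs ->] [s' hs' ->]|x y].
    by exists (s ++ s'); rewrite ?all_cat ?hs // big_cat.
  by exists [:: (x, y)]; rewrite // big_seq1.
move=> /asboolP[s hs ->]; elim: s hs => [|[a v] s IHs] /=.
  by exists [::]; rewrite ?big_nil.
move=> /andP[/andP[aI /IH[t ht E]] /IHs[t' ht' E']].
exists ([seq (p.1, a *: p.2) | p <- t] ++ t').
  rewrite all_cat ht' andbT all_map; apply: sub_all ht => p /= hp.
  exact: smul_mem.
rewrite big_cons big_cat big_map /= E' E scaler_sumr; congr (_ + _).
by apply: eq_bigr => p _; rewrite tensZr.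
Qed.

Let GN := gr_base I N.
Let GT := gr_base I (tensor M N).

Lemma gr_tens_ex (x : M) (h : GN) : exists h' : GT, forall j y,
  gr_comp j h = qpi _ y -> gr_comp j h' = qpi _ (tens x y).
Proof.
have [f ->] := gr_pi_surj h; have /asboolP[[k hk] hf] := valP f.
have [j||h' hh'] := @ex_gr A I (tensor M N) (fun j => tens x (val f j)).
- exact/tens_pow/hf.
- by exists k => j kj; rewrite hk // tens0.
exists h' => j y; rewrite hh' gr_comp_pi => /qpi_eq E; apply/qpi_eq.
have -> : tens x (val f j) - tens x y = tens x (val f j - y).
  by rewrite tensDr; congr (_ + _); rewrite -scaleN1r -[in RHS]scaleN1r tensZr.
exact: tens_pow.
Qed.

(** The formula holds for every lift [y] of a component, so bilinearity follows by picking
    convenient lifts. *)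
Lemma gr_tensor_ex : exists phi : {linear tensor M GN -> GT},
  forall x h j y, gr_comp j h = qpi _ y -> gr_comp j (phi (tens x h)) = qpi _ (tens x y).
Proof.
pose b x h := projT1 (cid (gr_tens_ex x h)).
have bE x h j y : gr_comp j h = qpi _ y -> gr_comp j (b x h) = qpi _ (tens x y).
  by rewrite /b; case: cid => h' /= h'E; exact: h'E.
have lay (h : GN) j : exists y, gr_comp j h = qpi _ y.
  by have [y _ ->] := gr_comp_layer j h; exists y.
have [||||phi hphi _] := @tensor_lift A M GN GT b.
- move=> x x' h; apply: gr_comp_inj => j; have [y hy] := lay h j.
  by rewrite linearD !(bE _ _ _ _ hy) tensDl linearD.
- move=> x h h'; apply: gr_comp_inj => j.
  have [y hy] := lay h j; have [y' hy'] := lay h' j.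
  rewrite linearD (bE _ _ _ _ hy) (bE _ _ _ _ hy') -linearD -tensDr.
  by apply: bE; rewrite !linearD hy hy'.
- move=> a x h; apply: gr_comp_inj => j; have [y hy] := lay h j.
  by rewrite linearZ !(bE _ _ _ _ hy) tensZl linearZ.
- move=> a x h; apply: gr_comp_inj => j; have [y hy] := lay h j.
  rewrite linearZ (bE _ _ _ _ hy) -linearZ -tensZr.
  by apply: bE; rewrite !linearZ hy.
by exists phi => x h j y; rewrite hphi; exact: bE.
Qed.

Definition gr_tensor : {linear tensor M GN -> GT} := projT1 (cid gr_tensor_ex).

Lemma gr_tensorE x h j y :
  gr_comp j h = qpi _ y -> gr_comp j (gr_tensor (tens x h)) = qpi _ (tens x y).
Proof. by rewrite /gr_tensor; case: cid => phi /= hp; exact: hp. Qed.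

Lemma gr_tensor_act g z : gr_tensor (tmapr M (gr_act N g) z) = gr_act _ g (gr_tensor z).
Proof.
apply: (@tensor_ext _ _ _ _ (comp_lin gr_tensor (tmapr M (gr_act N g)))
   (comp_lin (gr_act _ g) gr_tensor)) => x h.
apply: gr_comp_inj => k.
have /choice[y hy] (j : nat) : exists y, gr_comp j h = qpi _ y.
  by have [y _ ->] := gr_comp_layer j h; exists y.
have E : tmapr M (gr_act N g) (tens x h) = tens x (gr_act N g h) by exact: tmapE.
transitivity (gr_comp k (gr_tensor (tens x (gr_act N g h)))).
  by rewrite -E.
rewrite (gr_tensorE _ (gr_act_comp g k hy)) tens_sum.
rewrite [X in _ = gr_comp k X]/(gr_act _ g (gr_tensor (tens x h))).
rewrite (@gr_act_comp _ _ _ g _ (fun j => tens x (y j)) k) => [|j].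
  by congr (qpi _ _); apply: eq_bigr => i _; rewrite tensZr.
exact: gr_tensorE.
Qed.

Lemma gr_tensor_surj w : exists z, gr_tensor z = w.
Proof.
have hom j u : u \in pow_mul I (tensor M N) j -> exists z : tensor M GN,
    gr_comp j (gr_tensor z) = qpi _ u /\ forall k, k != j -> gr_comp k (gr_tensor z) = 0.
  move=> /pow_tens[s hs ->]; elim: s hs => [|[x y] s IHs] hs.
    by exists 0; split=> [|k _]; rewrite ?big_nil !linear0.
  have /andP[yj /IHs[z [hz zk]]] : (y \in pow_mul I N j) &&
    all (fun p => p.2 \in pow_mul I N j) s := hs.
  have [h [hh hk]] := ex_gr_hom yj.
  exists (tens x h + z); split=> [|k kj].
    by rewrite big_cons !linearD hz (gr_tensorE x hh).
  rewrite !linearD zk // addr0 (@gr_tensorE x h k 0) ?tens0 ?linear0 //.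
  by rewrite hk ?linear0.
have H j : exists z : tensor M GN, gr_comp j (gr_tensor z) = gr_comp j w /\
    forall k, k != j -> gr_comp k (gr_tensor z) = 0.
  by have [u hu ->] := gr_comp_layer j w; exact: hom.
have [z hz] := choice H; have [k hk] := gr_comp_bound w.
exists (\sum_(j < k) z j); rewrite linear_sum; symmetry.
apply: (@gr_comp_sum _ _ _ w (fun j => gr_tensor (z j)) k hk) => [j|j i ij].
  by case: (hz j).
by case: (hz j) => _; apply.
Qed.

(** In degree j the vanishing of Tor_1(M, N/I^j N) embeds M (x) (I^j N/I^(j+1) N) into M (x)
    N/I^(j+1) N, where the component can be read off from its image in G_I(M (x) N). *)
Lemma gr_tensor_inj :
  (forall j, tor_tors 1 0 M (quotmod (pow_mul I N j))) -> injective gr_tensor.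
Proof.
move=> MT; apply: lin_inj => z hz.
have [S [inc [p [io [pr [hs hsum hpr]]]]]] := gr_direct_sum I N.
apply: (tensor_direct_sum hsum) => j; apply/tors_elt1.
apply: (MT j _ _ _ _ (hs j)).
rewrite (@tmapr_comp _ _ _ _ _ _ _ (gr_comp j) (hpr j)).
(* [chi] is the natural map from (M (x) N)/I^(j+1)(M (x) N) to M (x) (N/I^(j+1) N). *)
have [|chi hchi] := lin_lift_surj (f := tmapr M (qpi (pow_mul I N j.+1)))
    (@qpi_surj _ _ (pow_mul I (tensor M N) j.+1)).
  move=> u /qpi_eq0/pow_tens[s hs' ->]; rewrite linear_sum big_seq big1 // => q qs.
  rewrite tmapE; have /qpi_eq0 -> := allP hs' q qs.
  by rewrite -(scale0r 0) tensZr scale0r.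
have -> : tmapr M (gr_comp j) z = chi (gr_comp j (gr_tensor z)).
  apply: (@tensor_ext _ _ _ _ (tmapr M (gr_comp j))
     (comp_lin chi (comp_lin (gr_comp j) gr_tensor))) => x h.
  have [y _ hy] := gr_comp_layer j h.
  transitivity (chi (qpi _ (tens x y))); first by rewrite hchi !tmapE hy.
  by congr (chi _); apply: esym; exact: gr_tensorE.
by rewrite hz !linear0.
Qed.

End GradedTensor.

(** * Depth *)

Section Grade.
Variables (R : comNzRingType) (X : lmodType R) (J : {pred R}).

Lemma grade_none : (forall x : X, x \in smul J predT) -> grade X J = None.
Proof. by rewrite /grade; case: pselect. Qed.

Lemma grade_some : ~ (forall x : X, x \in smul J predT) ->
  grade X J = enat_sup (fun n => exists s : seq R,
    [/\ size s = n, {subset s <= J} & regular_seq X s]).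
Proof. by rewrite /grade; case: pselect. Qed.

End Grade.

Section DepthTransfer.
Variables (A : comNzRingType) (m I : idealr A) (d : nat).
Hypotheses (mloc : noetherian_local m) (dimA : ring_dim A = Some d) (d_gt0 : (0 < d)%N).

Lemma maximal_CM_tor (M : lmodType A) : maximal_CM m M ->
  forall X, tors_fd m X -> forall n, tor_tors 1 n M X.
Proof.
move=> [[fM _ gM] dM] X [Xt Xfd] n.
(* As the grade equals the finite d, its infinite default is excluded; as d >= 1, it is attained by
   a regular sequence of length d. *)
move: gM; rewrite dM dimA /grade; case: pselect => // _ /enat_sup_some[_ hd].
have [s [sd sm [reg _]]] := hd d_gt0.
apply: (tor_tors_regular_module mloc dimA Xt Xfd (a := fun i => s`_i)) => // [i id|i id x].
  by apply/sm/mem_nth; rewrite sd.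
have si : (i < size s)%N by rewrite sd.
by move=> /(seq_mul_scale _ (ltnW si))/(reg i si)/(seq_mul_scale _ (ltnW si)).
Qed.

Variable N : lmodType A.
Hypothesis hI : ideal_of_definition m I N.
Hypothesis hpd : forall n : nat, pdim (quotmod (pow_mul I N n.+1)) <> None.

Lemma quot_pow_fd j : exists n0, forall Y n, (n0 <= n)%N ->
  tor_tors 1 n Y (quotmod (pow_mul I N j)).
Proof.
case: j => [|j].
  exists 0%N => Y n _; apply/tor_torsC/tor_tors_zero => q; have [x <-] := qpi_surj q.
  exact/qpi_eq0.
have [n0 hn0] := enat_inf_none (@hpd j).
by exists n0 => Y n; apply: tor_tors_resolution.
Qed.

Lemma quot_pow_tors_fd j : tors_fd m (quotmod (pow_mul I N j)).
Proof.
split; first by move=> x xm z; exact: (quot_pow_tors mloc hI xm z).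
by have [n0 h] := quot_pow_fd j; exists n0 => Y n _; exact: h.
Qed.

Lemma gr_tors_fd : tors_fd m (gr_base I N).
Proof.
have [S [inc [p [io [pr [hs hsum _]]]]]] := gr_direct_sum I N.
have St j x : x \in m -> forall z : S j, tors_elt x z.
  move=> xm z; have [iI _ _] := hs j; apply: (tors_elt_inj iI).
  exact: (quot_pow_tors mloc hI xm).
split=> [x xm z|].
  have [k /(_ k (leqnn k)) ->] := hsum z.
  elim/big_ind: _ => [|u v|j _]; [exact: tors_elt0 | exact: tors_eltD|].
  exact/tors_elt_map/St.
(* The bounds from [quot_pow_fd] vary with j; [tor_tors_fg_vanish] makes d work for all layers at
   once. *)
exists d => Y n fY dn; apply: (tor_tors_direct_sum hsum) => j.
apply: (tor_tors_fg_vanish mloc dimA (St j)) => //.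
have [n1 h1] := quot_pow_fd j.+1; have [n2 h2] := quot_pow_fd j.
exists (maxn n1 n2) => Z k _; rewrite geq_max => /andP[k1 k2].
apply/tor_torsC/(tor_tors_left (hs j)); apply/tor_torsC; first exact: h1.
by apply: h2; apply: leqW.
Qed.

Lemma depth_gr_tensor (M : lmodType A) : maximal_CM m M ->
  enat_le (depth_gr m I N) (depth_gr m I (tensor M N)).
Proof.
move=> hM; have MT := maximal_CM_tor hM.
have phiI : injective (@gr_tensor A I M N).
  by apply: gr_tensor_inj => j; apply: MT; exact: quot_pow_tors_fd.
have phiS := @gr_tensor_surj A I M N.
rewrite /depth_gr; set GN := gr_mod I N; set GT := gr_mod I (tensor M N).
have [hT|nT] := pselect (forall x : GT, x \in smul (gr_max I m) predT).
  by rewrite (grade_none hT); case: (grade GN _).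
(* The infinite value of the grade for G_I(N) passes to G_I(M (x) N) along the surjective comparison
   map, against [nT]. *)
have [hJ|nJ] := pselect (forall x : GN, x \in smul (gr_max I m) predT).
  case: nT => w; have [z <-] := phiS w.
  elim/tensor_ind: z => [u v /asboolP[s hs Es] /asboolP[s' hs' Es']|x h].
    apply/asboolP; exists (s ++ s'); first by rewrite all_cat hs.
    by rewrite linearD big_cat -Es -Es'.
  have /asboolP[s hs ->] := hJ h.
  apply/asboolP.
  exists [seq (p.1, gr_tensor I M N (tens x (p.2 : gr_base I N)) : GT) | p <- s].
    by rewrite all_map; apply: sub_all hs => p /= /andP[-> _].
  rewrite big_map; elim: s {hs} => [|p s IHs].
    by rewrite !big_nil tens0 linear0.
  rewrite !big_cons tensDr linearD; congr (_ + _) => //.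
  have -> : tens x (p.1 *: p.2 : gr_base I N) =
      tmapr M (gr_act N p.1) (tens x (p.2 : gr_base I N)) by rewrite tmapE.
  exact: gr_tensor_act.
rewrite (grade_some nT) (grade_some nJ).
apply: enat_sup_le => n [s [sn sJ [reg _]]]; exists s; split=> //.
have regE : endo_regular (fun j => gr_act N s`_j) n.
  move=> i; rewrite -sn => si x.
  by move=> /(seq_mul_act _ (ltnW si))/(reg i si)/(seq_mul_act _ (ltnW si)).
have regT := tensor_endo_regular MT (fun i j => gr_actC s`_i s`_j) gr_tors_fd regE.
(* The comparison map is bijective and commutes with G_I(A), so it transports regularity. *)
have phiU i z : endo_sum (fun j => gr_act (tensor M N) s`_j) i (gr_tensor I M N z) <->
    endo_sum (fun j => tmapr M (gr_act N s`_j)) i z.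
  split=> [[y E]|[y ->]].
    have /choice[v hv] := fun j => phiS (y j); exists v; apply: phiI.
    rewrite E linear_sum; apply: eq_bigr => j _.
    by rewrite gr_tensor_act hv.
  exists (fun j => gr_tensor I M N (y j)); rewrite linear_sum.
  by apply: eq_bigr => j _; rewrite gr_tensor_act.
split=> [i si w|].
  have [z <-] := phiS w => /(seq_mul_act _ (ltnW si)) h.
  apply/(seq_mul_act _ (ltnW si)); apply/phiU.
  apply: (regT i); first by rewrite -sn.
  by apply/phiU; rewrite gr_tensor_act.
(* The sequence lies in [gr_max I m], which by [nT] does not generate all of G_I(M (x) N). *)
have /existsNP[w hw] := nT; exists w; apply/negP => /asboolP[y E]; apply: hw.
apply/asboolP; exists [seq (s`_i, y i) | i <- iota 0 (size s)].
  rewrite all_map; apply/allP => i; rewrite mem_iota /= add0n andbT => si.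
  by rewrite sJ // mem_nth.
by rewrite E big_map -(big_mkord predT (fun i => s`_i *: y i)) /index_iota subn0.
Qed.

End DepthTransfer.

Theorem mainTheorem6 (A : comNzRingType) (m : idealr A)
  (hA : gorenstein_local m) (hreg : ~ regular_local m)
  (d : nat) (hd : ring_dim A = Some d) (hd1 : (1 <= d)%N)
  (N : lmodType A) (hN : perfect N)
  (t : nat) (ht : mod_dim N = Some t) (ht1 : (1 <= t)%N)
  (I : idealr A) (hI : ideal_of_definition m I N)
  (hpd : forall n : nat, pdim (quotmod (pow_mul I N n.+1)) <> None)
  (M : lmodType A) (hM : maximal_CM m M) :
  enat_le (depth_gr m I N) (depth_gr m I (tensor M N)).
Proof. by case: hA => mloc _; exact: (depth_gr_tensor mloc hd hd1 hI hpd hM). Qed.
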